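(* Let $\mu>0$, $c_0>-1$, and $\nu=\pi/(2\mu)$. For $\ell=0,1,2,\dots$ and $j\in\mathbb{Z}$ let $$H_{\ell,j}(z_1,z_2)=E_{c_0+\nu\ell+i(j+1)/2}(z_1,z_2)\,z_2^j .$$ Then each of the two sets $$\big\{H_{2k,j}:\ j\in\mathbb{Z},\ k=0,1,2,\dots\big\}\quad\text{and}\quad\big\{H_{2k+1,j}:\ j\in\mathbb{Z},\ k=0,1,2,\dots\big\}$$ is an orthogonal system in $A^2(\mathcal{W}'_\mu)$.
   Context: For $\mu>0$, the truncated worm domain is $$\mathcal{W}'_\mu=\big\{(z_1,z_2)\in\mathbb{C}^2:\ z_2\neq 0,\ \big|z_1-e^{i\log|z_2|^2}\big|^2<1,\ \big|\log|z_2|^2\big|<\mu\big\}.$$ $A^2(\mathcal{W}'_\mu)$ is the Bergman space of holomorphic functions on $\mathcal{W}'_\mu$ that are square integrable with respect to Lebesgue measure, with the $L^2$ inner product. For $\eta\in\mathbb{C}$, $E_\eta$ is the holomorphic function on $\mathcal{W}'_\mu$ given by $$E_\eta(z)=e^{\eta L(z)},\qquad L(z)=\log\big(z_1e^{-i\log|z_2|^2}\big)+i\log|z_2|^2,$$ where $\log$ of a complex number denotes the principal branch (on $\mathcal{W}'_\mu$ the number $z_1e^{-i\log|z_2|^2}$ lies in the disk $\{|\zeta-1|<1\}$). A family of vectors is an orthogonal system if any two members with distinct indices are orthogonal. *)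

(* Defs.v *)
From HB Require Import structures.
From mathcomp Require Import all_boot all_order all_algebra.
From mathcomp Require Import all_classical all_reals all_analysis.
From mathcomp Require Import complex.

Set Implicit Arguments.
Unset Strict Implicit.
Unset Printing Implicit Defensive.

Import Order.TTheory GRing.Theory Num.Theory.
Import numFieldNormedType.Exports.

Local Open Scope classical_set_scope.
Local Open Scope ring_scope.
Local Open Scope complex_scope.

(* The regular module [R[i]^o] makes this a normed space over [R[i]], so that
   [differentiable] below is complex (Frechet) differentiability. *)
Notation C2 R := (R[i]^o * R[i]^o)%type.

Section ComplexFunctions.
Context {R : realType}.
Implicit Type z : R[i].

(* The norm [`|z|] of the library is [R[i]]-valued; this one is real-valued. *)
Definition cabs z : R := Normc.normc z.

Definition cexp z : R[i] :=
  (expR (complex.Re z) * cos (complex.Im z)) +i*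
  (expR (complex.Re z) * sin (complex.Im z)).

(* The principal argument, with values in ]-pi, pi] (for z = 0 the value is
   irrelevant). *)
Definition carg z : R :=
  let t := acos (complex.Re z / cabs z) in
  if 0 <= complex.Im z then t else - t.

Definition clog z : R[i] := ln (cabs z) +i* carg z.

Lemma cabs_gt0 z : z != 0 -> 0 < cabs z.
Proof.
move=> z0; rewrite lt_neqAle /cabs; case: z z0 => a b z0.
rewrite sqrtr_ge0 andbT eq_sym; apply: contra z0 => /eqP h.
by apply/eqP; exact: Normc.eq0_normc h.
Qed.

Lemma sqr_cabs z : cabs z ^+ 2 = complex.Re z ^+ 2 + complex.Im z ^+ 2.
Proof. by case: z => a b; rewrite sqr_sqrtr// addr_ge0// sqr_ge0. Qed.

Lemma Re_div_cabs z : z != 0 -> -1 <= complex.Re z / cabs z <= 1.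
Proof.
move=> /cabs_gt0 z0; rewrite -ler_norml normrM normfV (gtr0_norm z0).
rewrite ler_pdivrMr// mul1r -(@ler_sqr _ `|_|) ?nnegrE ?(ltW z0)//.
by rewrite real_normK ?num_real// sqr_cabs lerDl sqr_ge0.
Qed.

Lemma carg_itv z : z != 0 -> - pi < carg z <= pi.
Proof.
move=> z0; have xin := Re_div_cabs z0; rewrite /carg.
have t0 := acos_ge0 xin; have tpi := acos_lepi xin.
case: (leP 0 (complex.Im z)) => [_|Im0].
  by rewrite tpi andbT (lt_le_trans _ t0)// oppr_lt0 pi_gt0.
rewrite ltrN2 lt_neqAle tpi andbT; apply/andP; split; last first.
  by rewrite (le_trans _ (pi_ge0 R))// oppr_le0.
apply/eqP => /(congr1 cos); rewrite acosK// cospi => e.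
have : (complex.Re z / cabs z) ^+ 2 = 1 by rewrite e sqrrN expr1n.
rewrite expr_div_n => /divr1_eq; rewrite sqr_cabs => /eqP.
by rewrite eq_sym -subr_eq0 addrAC subrr add0r sqrf_eq0 (lt_eqF Im0).
Qed.

Lemma clogK z : z != 0 -> cexp (clog z) = z.
Proof.
move=> z0; have xin := Re_div_cabs z0; have r0 := cabs_gt0 z0.
have cosE : cos (carg z) = complex.Re z / cabs z.
  by rewrite /carg; case: ifP => _; rewrite ?cosN acosK.
have sinE : sin (carg z) = complex.Im z / cabs z.
  have e : Num.sqrt (1 - (complex.Re z / cabs z) ^+ 2) = `|complex.Im z| / cabs z.
    have -> : 1 - (complex.Re z / cabs z) ^+ 2 = (complex.Im z / cabs z) ^+ 2.
      rewrite !expr_div_n -[X in X - _](@divff _ (cabs z ^+ 2)).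
        by rewrite -mulrBl sqr_cabs addrAC subrr add0r.
      by rewrite sqrf_eq0 gt_eqF.
    by rewrite sqrtr_sqr normrM normfV (gtr0_norm r0).
  rewrite /carg; case: (leP 0 (complex.Im z)) => Im0; rewrite ?sinN sin_acos// e.
    by rewrite ger0_norm.
  by rewrite ltr0_norm// mulNr opprK.
rewrite /cexp /= lnK ?posrE// cosE sinE.
rewrite !(mulrC (cabs z)) !divfK ?gt_eqF//.
by case: z {xin r0 cosE sinE z0}.
Qed.

End ComplexFunctions.

Section BergmanSpace.
Context {R : realType}.
Implicit Types (Omega : set (C2 R)) (f g : C2 R -> R[i]^o).

Definition holomorphic_on Omega f : Prop :=
  forall z, Omega z -> differentiable f z.

(* The real coordinates ((x1, y1), (x2, y2)) on C^2. *)
Definition of_real4 (p : (R * R) * (R * R)) : C2 R :=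
  (p.1.1 +i* p.1.2, p.2.1 +i* p.2.2).

Definition lebesgue2 : set (measurableTypeR R * measurableTypeR R) -> \bar R :=
  (@lebesgue_measure R \x @lebesgue_measure R)%E.

HB.instance Definition _ := Measure.on lebesgue2.

Lemma lebesgue2_sigma_finite : sigma_finite setT lebesgue2.
Proof.
have /sigma_finiteP[F [TF ndF Foo]] := sigma_finiteT (@lebesgue_measure R).
exists (fun n => F n `*` F n) => [|k].
  rewrite -setXTT TF predeqE => -[x y]; split => [[/= [n _ Fnx] [k _ Fky]]|].
    exists (maxn n k) => //; split.
    - by move: x Fnx; exact/subsetPset/ndF/leq_maxl.
    - by move: y Fky; exact/subsetPset/ndF/leq_maxr.
  by move=> [n _ []/= ? ?]; split; exists n.
have [mFk Fk] := Foo k; split; first exact: measurableX.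
by rewrite /lebesgue2 product_measure1E// lte_mul_pinfty// ge0_fin_numE.
Qed.

HB.instance Definition _ :=
  Measure_isSigmaFinite.Build _ _ _ lebesgue2 lebesgue2_sigma_finite.

(* The products of [lebesgue_measure] are not inferred to be sigma-finite, hence
   the intermediate [lebesgue2]; this is Lebesgue measure on C^2 = R^4. *)
Definition lebesgue4 :
    set ((measurableTypeR R * measurableTypeR R) *
         (measurableTypeR R * measurableTypeR R)) -> \bar R :=
  (lebesgue2 \x lebesgue2)%E.

HB.instance Definition _ := Measure.on lebesgue4.

Definition square_integrable_on Omega f : Prop :=
  lebesgue4.-integrable (of_real4 @^-1` Omega)
    (fun p => (cabs (f (of_real4 p)) ^+ 2)%:E).

Definition bergman Omega : set (C2 R -> R[i]^o) :=
  [set f | holomorphic_on Omega f /\ square_integrable_on Omega f].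

Definition complex_integral Omega f : R[i] :=
  Rintegral lebesgue4 (of_real4 @^-1` Omega)
    (fun p => complex.Re (f (of_real4 p))) +i*
  Rintegral lebesgue4 (of_real4 @^-1` Omega)
    (fun p => complex.Im (f (of_real4 p))).

Definition bergman_inner Omega f g : R[i] :=
  complex_integral Omega (fun z => (f z : R[i]) * conjc (g z)).

Definition orthogonal_system Omega (I : Type) (F : I -> C2 R -> R[i]^o) : Prop :=
  (forall i, bergman Omega (F i)) /\
  (forall i j, i <> j -> bergman_inner Omega (F i) (F j) = 0).

End BergmanSpace.

Section Worm.
Context {R : realType}.
Implicit Types (mu : R) (z : C2 R) (eta : R[i]).

Definition logsq (w : R[i]) : R := ln (cabs w ^+ 2).

Definition truncated_worm mu : set (C2 R) :=
  [set z | [/\ z.2 != 0,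
               cabs ((z.1 : R[i]) - cexp ('i * (logsq z.2)%:C)) ^+ 2 < 1 &
               `|logsq z.2| < mu]].

Definition worm_L z : R[i] :=
  clog ((z.1 : R[i]) * cexp (- 'i * (logsq z.2)%:C)) + 'i * (logsq z.2)%:C.

Definition worm_E eta z : R[i] := cexp (eta * worm_L z).

Definition worm_H mu (c0 : R) (l : nat) (j : int) z : R[i]^o :=
  let nu := pi / (2 * mu) in
  worm_E ((c0 + nu * l%:R)%:C + 'i * ((j + 1)%:~R / 2)) z * (z.2 : R[i]) ^ j.

End Worm.

(* Main.v *)
(** No polar coordinates are needed: each inner product [I] is shown to satisfy
    [I = - I] by a linear change of variables, made piecewise if [j = j'].
    If [j <> j'], rotating [z2] by [pi / (j - j')] preserves the domain and changes the sign of
    [H_(l,j) * conj H_(l',j')].  If [j = j'], the map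
    [(z1, z2) |-> (e^(it) z1, e^(t/2) z2)] adds [it] to [L] and [t] to [log |z2|^2];
    it multiplies volume by [e^t] and [H_(l,j) * conj H_(l',j)] by
    [e^(-t) e^(i nu (l - l') t)].  As [l - l' = 2m], the last factor has period
    [2 mu] in [t] and is [-1] at [t = s := mu / |m|], so the cyclic shift of the
    interval [|log |z2|^2| < mu] by [s] (the map with [t = s] below [mu - s], the one
    with [t = s - 2 mu] above) changes the sign of the integral.

    Square integrability comes from [|H_(l,j)| <= C |z1|^a] with [a = c0 + nu l > -1].
    For holomorphy, [L] is continuous and [e^L = z1], so [L] is locally a branch of
    [log z1]. *)

Require Import Defs.
From HB Require Import structures.
From mathcomp Require Import all_boot all_order all_algebra.
From mathcomp Require Import all_classical all_reals all_analysis.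
From mathcomp Require Import measurable_realfun complex.
From mathcomp Require Import ring lra zify.

Set Implicit Arguments.
Unset Strict Implicit.
Unset Printing Implicit Defensive.

Import Order.TTheory GRing.Theory Num.Theory.
Import numFieldNormedType.Exports.

Local Open Scope classical_set_scope.
Local Open Scope ring_scope.

Local Notation Re := complex.Re.
Local Notation Im := complex.Im.

(** * Scaling of volume *)

(** Bundling [A |-> c * mu (phi^-1 A)] as a measure makes the uniqueness theorems for Lebesgue and
    product measure applicable: a Jacobian then has to be checked only on intervals or
    rectangles. *)
Lemma scaled_pushforward_measure {d d' : measure_display} {T : measurableType d}
    {T' : measurableType d'} {R : realType} (mu : {measure set T -> \bar R})
    (phi : T -> T') (c : R) :
  0 <= c -> measurable_fun setT phi ->
  {m : {measure set T' -> \bar R} |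
    forall A, m A = (c%:E * mu (phi @^-1` A))%E}.
Proof.
move=> c0 mphi.
unshelve refine (exist _
  (mscale (NngNum c0) (pushforward mu phi) : {measure set T' -> \bar R}) _).
  exact: mphi.
by [].
Qed.

Section ScalesMeasure.
Context {d : measure_display} {T : measurableType d} {R : realType}.
Variable mu : {measure set T -> \bar R}.

(* [c] is the Jacobian of [phi]: [phi] maps sets of measure [m] to sets of
   measure [c * m]. *)
Definition scales_measure (phi : T -> T) (c : R) : Prop :=
  measurable_fun setT phi /\
  forall A, measurable A -> mu A = (c%:E * mu (phi @^-1` A))%E.

Lemma scales_measure_id : scales_measure id 1.
Proof. by split=> // A _; rewrite mul1e preimage_id. Qed.

Lemma scales_measure_comp (phi psi : T -> T) (c c' : R) :
  scales_measure phi c -> scales_measure psi c' ->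
  scales_measure (phi \o psi) (c * c').
Proof.
move=> [mphi phiE] [mpsi psiE]; split; first exact: measurableT_comp.
move=> A mA; rewrite (phiE A mA) (psiE (phi @^-1` A)).
  by rewrite EFinM muleA.
by rewrite -[X in measurable X]setTI; exact: mphi.
Qed.

(** On measurable sets [mu] is [c] times its own pushforward under [phi], so this is the change of
    variables for a pushforward followed by scaling of the measure. *)
Lemma ge0_integral_scales (phi : T -> T) (c : R) (D : set T) (f : T -> \bar R) :
  0 <= c -> scales_measure phi c -> measurable D -> measurable_fun D f ->
  (forall x, D x -> 0 <= f x)%E ->
  (\int[mu]_(x in D) f x =
   c%:E * \int[mu]_(x in phi @^-1` D) f (phi x))%E.
Proof.
move=> c0 [mphi phiE] mD mf f0.
have f0' : {in D, forall y, 0 <= f y}%E by move=> y /set_mem; exact: f0.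
rewrite -[X in (_ = _ * X)%E]
  (@ge0_integral_pushforward _ _ _ _ _ phi mphi mu D f mD mf f0').
have [m mE] := scaled_pushforward_measure mu ler01 mphi.
have mfx : pushforward mu phi = m.
  by apply/funext => A; rewrite mE mul1e.
rewrite mfx.
have -> : c%:E = (NngNum c0)%:num%:E by [].
rewrite -(ge0_integral_mscale m mD (NngNum c0) mf f0).
apply: eq_measure_integral => A mA _.
by rewrite (phiE A mA) -[mu _]mul1e -mE.
Qed.

(** The Jacobian [c] cancels the factor [c^-1] and only the sign is left: the integral of the
    positive part over [D] becomes that of the negative part over the preimage, and vice versa. *)
Lemma Rintegral_scales_opp (phi : T -> T) (c : R) (D : set T) (f : T -> R) :
  0 < c -> scales_measure phi c -> measurable D ->
  mu.-integrable D (EFin \o f) ->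
  (forall x, D (phi x) -> f (phi x) = - (c^-1 * f x)) ->
  (\int[mu]_(x in D) f x = - \int[mu]_(x in phi @^-1` D) f x)%R.
Proof.
move=> c0 phic mD intf fphi.
have mf : measurable_fun D (EFin \o f) by exact: measurable_int intf.
have mfr : measurable_fun D f by exact/measurable_EFinP.
have cN0 : c != 0 by rewrite gt_eqF.
have mD' : measurable (phi @^-1` D).
  by rewrite -[X in measurable X]setTI; apply: phic.1.
have mphi : measurable_fun (phi @^-1` D) phi.
  by apply: measurable_funTS; exact: phic.1.
(* On the preimage [f x = - c * f (phi x)], so measurability is inherited from [D]. *)
have mf' : measurable_fun (phi @^-1` D) (EFin \o f).
  apply/measurable_EFinP.
  apply: (@eq_measurable_fun _ _ _ _ _ (fun x => - c * f (phi x))).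
    move=> x /set_mem Dx.
    by rewrite /= fphi// mulrNN mulrA divff// mul1r.
  apply: measurable_funM => //.
  by apply: (measurable_comp mD _ mfr mphi) => _ [x Dx <-].
have posE : (\int[mu]_(x in D) (EFin \o f)^\+ x =
    \int[mu]_(x in phi @^-1` D) (EFin \o f)^\- x)%E.
  rewrite (ge0_integral_scales (ltW c0) phic mD)//; last first.
    exact: measurable_funepos.
  rewrite -ge0_integralZl//; last 2 first.
  - by apply: (measurable_comp mD _ (measurable_funepos mf) mphi) => _ [x Dx <-].
  - by rewrite lee_fin ltW.
  apply: eq_integral => x /set_mem Dx.
  rewrite funeposE funenegE /= fphi// -?EFinN -!EFin_max -EFinM; congr EFin.
  rewrite maxr_pMr ?(ltW c0)// mulr0; congr Num.max.
  by rewrite mulrN mulrA divff// mul1r.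
have negE : (\int[mu]_(x in D) (EFin \o f)^\- x =
    \int[mu]_(x in phi @^-1` D) (EFin \o f)^\+ x)%E.
  rewrite (ge0_integral_scales (ltW c0) phic mD)//; last first.
    exact: measurable_funeneg.
  rewrite -ge0_integralZl//; last 2 first.
  - by apply: (measurable_comp mD _ (measurable_funeneg mf) mphi) => _ [x Dx <-].
  - by rewrite lee_fin ltW.
  apply: eq_integral => x /set_mem Dx.
  rewrite funeposE funenegE /= fphi// -?EFinN -!EFin_max -EFinM; congr EFin.
  rewrite maxr_pMr ?(ltW c0)// mulr0; congr Num.max.
  by rewrite opprK mulrA divff// mul1r.
rewrite /Rintegral integralE posE negE [in RHS]integralE.
(* Finiteness of one of the two integrals is enough to negate their difference in the extended
   reals. *)
have : (\int[mu]_(x in phi @^-1` D) (EFin \o f)^\- x)%E \is a fin_num.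
  by rewrite -posE; apply: integrable_fin_num => //; exact: integrable_funepos.
move: (integral _ _ _) (integral _ _ _) => I J Ifin.
by rewrite -fineN fin_num_oppeB// addeC.
Qed.

End ScalesMeasure.

Section ProductScales.
Context {d1 d2 : measure_display} {T1 : measurableType d1}
  {T2 : measurableType d2} {R : realType}.
Variable m1 : {sigma_finite_measure set T1 -> \bar R}.
Variable m2 : {sigma_finite_measure set T2 -> \bar R}.

(** The scaled pushforward agrees with the product measure on rectangles, where the two Jacobians
    multiply; uniqueness of the product measure does the rest. *)
Lemma scales_measure_prod (phi1 : T1 -> T1) (phi2 : T2 -> T2) (c1 c2 : R) :
  0 <= c1 -> 0 <= c2 ->
  scales_measure m1 phi1 c1 -> scales_measure m2 phi2 c2 ->
  scales_measure (m1 \x m2)%E (fun p => (phi1 p.1, phi2 p.2)) (c1 * c2).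
Proof.
move=> c10 c20 [mphi1 phi1E] [mphi2 phi2E].
have mphi : measurable_fun [set: T1 * T2] (fun p => (phi1 p.1, phi2 p.2)).
  by apply: measurable_fun_pair; apply: measurableT_comp.
split=> // X mX.
have [m' m'E] := scaled_pushforward_measure (m1 \x m2)%E (mulr_ge0 c10 c20) mphi.
rewrite -m'E; apply: product_measure_unique => // A B mA mB; rewrite m'E.
rewrite (_ : _ @^-1` _ = (phi1 @^-1` A) `*` (phi2 @^-1` B))//.
rewrite /= product_measure1E.
- rewrite EFinM muleACA; congr (_ * _)%E; apply/esym; first exact: phi1E.
  exact: phi2E.
- by rewrite -[X in measurable X]setTI; exact: mphi1.
- by rewrite -[X in measurable X]setTI; exact: mphi2.
Qed.

End ProductScales.

(** * Jacobians of translations, dilations, shears and rotations *)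

Section LebesgueScales.
Context {R : realType}.
Local Notation leb := (@lebesgue_measure R).

(** Lebesgue measure is determined by its values on half-open intervals, and the preimage of such an
    interval is one of the same length. The dilation below is treated in the same way. *)
Lemma scales_lebesgue_translation (a : R) :
  scales_measure leb (fun x : measurableTypeR R => (x : R) + a) 1.
Proof.
have mphi : measurable_fun setT
    (fun x : measurableTypeR R => (x : R) + a : measurableTypeR R).
  exact: measurable_funD.
split=> // A mA.
have [m mE] := scaled_pushforward_measure leb ler01 mphi.
rewrite -mE; apply: lebesgue_measure_unique => //= _ [[x y]] _ <-.
rewrite mE mul1e.
rewrite (_ : _ @^-1` _ = `]x - a, y - a]%classic); last first.
  by apply/seteqP; split=> z /=; rewrite !in_itv/= ltrBlDr lerBrDr.
rewrite (lebesgue_measure_itv `]x, y]).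
rewrite [RHS](lebesgue_measure_itv `]x - a, y - a])/= !lte_fin ltrD2r.
case: ifP => // _.
by rewrite -!EFinD; congr EFin; ring.
Qed.

Lemma scales_lebesgue_dilation (k : R) : 0 < k ->
  scales_measure leb (fun x : measurableTypeR R => k * (x : R)) k.
Proof.
move=> k0.
have mphi : measurable_fun setT
    (fun x : measurableTypeR R => k * (x : R) : measurableTypeR R).
  exact: measurable_funM.
split=> // A mA.
have [m mE] := scaled_pushforward_measure leb (ltW k0) mphi.
rewrite -mE; apply: lebesgue_measure_unique => //= _ [[x y]] _ <-.
rewrite mE.
rewrite (_ : _ @^-1` _ = `]x / k, y / k]%classic); last first.
  apply/seteqP; split=> z /=;
  by rewrite !in_itv/= ltr_pdivrMr// ler_pdivlMr// ![z * k]mulrC.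
rewrite (lebesgue_measure_itv `]x, y]).
rewrite [X in (_ = _ * X)%E](lebesgue_measure_itv `]x / k, y / k])/=.
rewrite !lte_fin ltr_pM2r ?invr_gt0//.
case: ifP => // _; last by rewrite mule0.
by rewrite -!EFinD -EFinM mulrBr !mulrA ![k * _]mulrC !mulfK ?gt_eqF.
Qed.

Local Notation R2 := (measurableTypeR R * measurableTypeR R)%type.
Local Notation leb2 := (@lebesgue2 R).

(** Conjugation by the swap turns a vertical shear into a horizontal one. *)
Lemma scales_lebesgue2_swap : scales_measure leb2 (fun p : R2 => (p.2, p.1)) 1.
Proof.
have mphi : measurable_fun setT (fun p : R2 => (p.2, p.1)).
  by apply: measurable_fun_pair.
split=> // A mA.
have [m mE] := scaled_pushforward_measure leb2 ler01 mphi.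
rewrite -mE; apply: product_measure_unique => // B C mB mC.
rewrite mE mul1e (_ : _ @^-1` _ = C `*` B).
  by rewrite [LHS]product_measure1E// muleC.
by apply/seteqP; split=> [[x y] []|[x y] []].
Qed.

(** The product measure integrates the measures of the vertical sections, and the section at [x] is
    only translated, by [b * x]. *)
Lemma scales_lebesgue2_shear (b : R) :
  scales_measure leb2 (fun p : R2 => (p.1, (p.2 : R) + b * (p.1 : R))) 1.
Proof.
have mphi : measurable_fun setT
    (fun p : R2 => (p.1, (p.2 : R) + b * (p.1 : R) : measurableTypeR R)).
  apply: measurable_fun_pair => //; apply: measurable_funD => //.
  exact: measurable_funM.
split=> // A mA; rewrite mul1e /lebesgue2 /product_measure1.
apply: eq_integral => x _ /=.
have [_ /(_ _ (measurable_xsection x mA))] := scales_lebesgue_translation (b * x).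
rewrite mul1e => ->; congr (leb _).
Qed.

(** Multiplication by the complex number [c + i s] in real coordinates. *)
Definition rot (c s : R) (p : R2) : R2 :=
  (c * (p.1 : R) - s * (p.2 : R), s * (p.1 : R) + c * (p.2 : R)).

Lemma scales_lebesgue2_rot (c s : R) : c ^+ 2 + s ^+ 2 = 1 ->
  scales_measure leb2 (rot c s) 1.
Proof.
(* A rotation with [s != 0] is a product of three shears; the remaining
   nontrivial one is the square of the quarter turn. *)
have shear_rot c' s' : c' ^+ 2 + s' ^+ 2 = 1 -> s' != 0 ->
    scales_measure leb2 (rot c' s') 1.
  (* For a rotation by the angle [t] this is [a = - tan (t/2)]; [sx] is the horizontal shear by
     [a]. *)
  move=> cs s0; pose a := (c' - 1) / s'.
  have sx := scales_measure_comp scales_lebesgue2_swap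
    (scales_measure_comp (scales_lebesgue2_shear a) scales_lebesgue2_swap).
  have := scales_measure_comp sx
    (scales_measure_comp (scales_lebesgue2_shear s') sx).
  rewrite !mul1r; congr scales_measure; apply/funext => -[x y]; rewrite /rot /=.
  have as' : a * s' = c' - 1 by rewrite /a divfK.
  have aE : a * (1 + c') = - s'.
    apply: (mulIf s0); rewrite mulrAC as' mulNr -expr2.
    have -> : s' ^+ 2 = 1 - c' ^+ 2 by rewrite -cs addrAC subrr add0r.
    by ring.
  have e1 : y + s' * (x + a * y) = s' * x + c' * y.
    have -> : y + s' * (x + a * y) = s' * x + (1 + a * s') * y by ring.
    by rewrite as'; congr (_ + _ * _); ring.
  rewrite e1; congr pair.
  have -> : x + a * y + a * (s' * x + c' * y) =
      (1 + a * s') * x + (a * (1 + c')) * y by ring.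
  by rewrite as' aE; ring.
move=> cs; have [s0|s0] := eqVneq s 0; last exact: shear_rot.
have : (c == 1) || (c == -1).
  by rewrite -eqf_sqr expr1n -cs s0 expr0n addr0.
case/orP => /eqP cE.
  have -> : rot c s = id.
    by apply/funext => -[x y]; rewrite /rot s0 cE /= !mul0r !mul1r subr0 add0r.
  exact: scales_measure_id.
have r01 := shear_rot 0 1 _ (oner_neq0 _).
have := scales_measure_comp (r01 _) (r01 _); rewrite mul1r.
have -> : rot 0 1 \o rot 0 1 = rot c s.
  apply/funext => -[x y]; rewrite /rot s0 cE /=; congr pair; ring.
by apply; rewrite expr0n expr1n add0r.
Qed.

Lemma scales_lebesgue2_dilation (k : R) : 0 < k ->
  scales_measure leb2 (fun p : R2 => (k * (p.1 : R), k * (p.2 : R))) (k ^+ 2).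
Proof.
move=> k0; have dk := scales_lebesgue_dilation k0.
by rewrite expr2; exact: (scales_measure_prod (ltW k0) (ltW k0) dk dk).
Qed.

End LebesgueScales.

(** * Complex exponential and logarithm *)

Section ComplexExp.
Local Open Scope complex_scope.
Context {R : realType}.
Implicit Types (z w : R[i]).

Lemma normC_cabs z : `|z| = (cabs z)%:C.
Proof. by []. Qed.

Lemma cabs_ge0 z : 0 <= cabs z.
Proof. by case: z => a b; exact: sqrtr_ge0. Qed.

Lemma cabsN z : cabs (- z) = cabs z.
Proof. by case: z => a b; rewrite /cabs /= !sqrrN. Qed.

Lemma cabsM z w : cabs (z * w) = cabs z * cabs w.
Proof. exact: Normc.normcM. Qed.

Lemma conjcM z w : conjc (z * w) = conjc z * conjc w.
Proof. exact: rmorphM. Qed.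

Lemma cabs_conjc z : cabs (conjc z) = cabs z.
Proof. by case: z => a b; rewrite /cabs /= sqrrN. Qed.

Lemma cabsV z : cabs z^-1 = (cabs z)^-1.
Proof. exact: Normc.normcV. Qed.

Lemma cabsX z n : cabs (z ^+ n) = cabs z ^+ n.
Proof.
elim: n => [|n ih]; first by rewrite !expr0; exact: Normc.normc1.
by rewrite !exprS cabsM ih.
Qed.

Lemma cabsD z w : cabs (z + w) <= cabs z + cabs w.
Proof. by rewrite -lecR rmorphD; exact: (ler_normD z w). Qed.

Lemma cabs_le_ReIm z : cabs z <= `|Re z| + `|Im z|.
Proof.
rewrite -(@ler_sqr _ (cabs z)) ?nnegrE ?cabs_ge0 ?addr_ge0//.
rewrite sqr_cabs sqrrD !real_normK ?num_real//.
have : 0 <= `|Re z| * `|Im z| by rewrite mulr_ge0.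
by rewrite mulr2n; lra.
Qed.

Lemma Re_le_cabs z : `|Re z| <= cabs z.
Proof.
rewrite -(@ler_sqr _ `|_|) ?nnegrE ?cabs_ge0//.
by rewrite sqr_cabs real_normK ?num_real// lerDl sqr_ge0.
Qed.

Lemma Im_le_cabs z : `|Im z| <= cabs z.
Proof.
rewrite -(@ler_sqr _ `|_|) ?nnegrE ?cabs_ge0//.
by rewrite sqr_cabs real_normK ?num_real// lerDr sqr_ge0.
Qed.

Lemma cReM z w : Re (z * w) = Re z * Re w - Im z * Im w.
Proof. by case: z w => [a b] [c d]. Qed.

Lemma cImM z w : Im (z * w) = Re z * Im w + Im z * Re w.
Proof. by case: z w => [a b] [c d]. Qed.

Lemma cReD z w : Re (z + w) = Re z + Re w.
Proof. by case: z w => [a b] [c d]. Qed.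

Lemma cImD z w : Im (z + w) = Im z + Im w.
Proof. by case: z w => [a b] [c d]. Qed.

Lemma cReN z : Re (- z) = - Re z. Proof. by case: z. Qed.

Lemma cImN z : Im (- z) = - Im z. Proof. by case: z. Qed.

Lemma cexpD z w : cexp (z + w) = cexp z * cexp w.
Proof.
apply/eqP; rewrite eq_complex cReM cImM /= cReD cImD expRD cosD sinD.
by apply/andP; split; apply/eqP; ring.
Qed.

Lemma cexp0 : cexp 0 = 1 :> R[i].
Proof. by rewrite /cexp /= expR0 cos0 sin0 mulr0 mul1r. Qed.

Lemma cabs_cexp z : cabs (cexp z) = expR (Re z).
Proof.
apply/eqP; rewrite -(@eqrXn2 _ 2)// ?cabs_ge0 ?expR_ge0// sqr_cabs /=.
by rewrite !exprMn -mulrDr cos2Dsin2 mulr1.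
Qed.

Lemma cexp_neq0 z : cexp z != 0.
Proof.
apply/eqP => /(congr1 cabs); rewrite cabs_cexp => e.
have := expR_gt0 (Re z); rewrite e.
by rewrite (_ : cabs 0 = 0) ?ltxx//; exact: Normc.normc0.
Qed.

Lemma cexpN z : cexp (- z) = (cexp z)^-1.
Proof.
apply: (mulfI (cexp_neq0 z)); rewrite -cexpD subrr cexp0.
by rewrite divff// cexp_neq0.
Qed.

Lemma cexp_i (t : R) : cexp ('i * t%:C) = cos t +i* sin t.
Proof.
rewrite /cexp cReM cImM /= !mul0r !mul1r subr0 add0r.
by rewrite expR0 !mul1r.
Qed.

Lemma cexp_exprz w (j : int) : cexp w ^ j = cexp (j%:~R * w).
Proof.
have h n : cexp w ^+ n = cexp (n%:R * w).
  elim: n => [|n ih]; first by rewrite expr0 mul0r cexp0.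
  by rewrite exprS ih -cexpD -nat1r mulrDl mul1r.
case: j => n; first exact: h.
have -> : (Negz n)%:~R = - n.+1%:R :> R[i] by rewrite NegzE mulrNz.
have -> : cexp w ^ Negz n = (cexp w ^+ n.+1)^-1 by [].
by rewrite h mulNr cexpN.
Qed.

Lemma conjc_cexp w : conjc (cexp w) = cexp (conjc w).
Proof. by case: w => a b; rewrite /cexp /= cosN sinN mulrN. Qed.

Lemma cexp_ipi : cexp ('i * (pi : R)%:C) = -1 :> R[i].
Proof.
by rewrite cexp_i cospi sinpi; apply/eqP; rewrite eq_complex /= oppr0 !eqxx.
Qed.

(** The exponential form treats both signs of [j] alike and makes bounds on the modulus linear in
    [ln |w|]. *)
Lemma cabs_exprz w (j : int) : w != 0 ->
  cabs (w ^ j) = expR (j%:~R * ln (cabs w)).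
Proof.
move=> w0; have c0 := cabs_gt0 w0; case: j => n.
  have -> : (Posz n)%:~R = n%:R :> R by [].
  by rewrite expRM_natl lnK ?posrE// -cabsX.
have -> : (Negz n)%:~R = - n.+1%:R :> R by rewrite NegzE mulrNz.
have -> : w ^ Negz n = (w ^+ n.+1)^-1 by [].
by rewrite mulNr expRN expRM_natl lnK ?posrE// cabsV cabsX.
Qed.

(* Unlike the two-case formula defining [carg], this one makes continuity and
   measurability immediate. *)
Lemma carg_atan z : 0 < Re z -> carg z = atan (Im z / Re z).
Proof.
move=> Rez; set t := Im z / Re z.
have z0 : z != 0 by apply: contraTneq Rez => ->; rewrite ltxx.
have cosE : cos (atan t) = Re z / cabs z.
  rewrite cos_atan (_ : cabs z = Re z * Num.sqrt (1 + t ^+ 2)).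
    by rewrite invfM mulrA divff ?gt_eqF// mul1r.
  apply/eqP; rewrite -(@eqrXn2 _ 2)// ?cabs_ge0 ?mulr_ge0 ?sqrtr_ge0 ?(ltW Rez)//.
  rewrite sqr_cabs exprMn sqr_sqrtr ?addr_ge0 ?sqr_ge0//.
  by rewrite /t expr_div_n mulrDr mulr1 mulrCA divff ?mulr1// sqrf_eq0 gt_eqF.
have pi2 : pi / 2 <= pi :> R by have := pi_ge0 R; lra.
rewrite /carg -cosE; case: ifPn => Imz.
  have t0 : 0 <= t by rewrite divr_ge0 ?(ltW Rez).
  rewrite cosK// in_itv /= (le_trans _ (le_atan t0)) ?atan0//=.
  by rewrite (le_trans (ltW (atan_ltpi2 _))).
have t0 : t <= 0 by rewrite /t pmulr_lle0 ?invr_gt0// ltW// ltNge.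
rewrite cosKN ?opprK// (le_trans (le_atan t0)) ?atan0// andbT.
by rewrite (le_trans _ (ltW (atan_gtNpi2 _)))// lerN2.
Qed.

End ComplexExp.

(** * Complex differentiability of the exponential *)

Section ComplexDifferentiability.
Local Open Scope complex_scope.
Context {R : realType}.
Implicit Types (z w : R[i]).

(** The limit of the difference quotient, multiplied through by [h] so that [h = 0] is included. *)
Lemma is_derive_near (f : R -> R) (x df e : R) : is_derive x 1 f df -> 0 < e ->
  \forall h \near (0 : R), `|f (h + x) - f x - df * h| <= e * `|h|.
Proof.
move=> [fx dfE] e0.
have : (h^-1 *: (f (h *: 1 + x) - f x)) @[h --> 0^'] --> df.
  by rewrite -dfE; exact: fx.
move=> /cvgrPdist_le /(_ _ e0); rewrite near_withinE => H.
near=> h; have [->|h0] := eqVneq h 0.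
  by rewrite add0r subrr mulr0 subrr normr0 mulr0.
have : `|df - h^-1 *: (f (h *: 1 + x) - f x)| <= e.
  by move: h0; near: h; exact: H.
rewrite -(@ler_pM2r _ `|h|) ?normr_gt0// -normrM mulrBl /GRing.scale /= mulr1.
by rewrite mulrAC mulVf// mul1r distrC.
Unshelve. all: by end_near. Qed.

Lemma near0_ball (P : R -> Prop) : (\forall h \near (0 : R), P h) ->
  exists2 d, 0 < d & forall x, `|x| < d -> P x.
Proof. by move=> /nbhs_norm0P. Qed.

(** Obtained from the derivatives of [expR], [cos] and [sin] at 0. It serves twice: to differentiate
    [cexp] at every point, and to invert it locally when [L] is differentiated. *)
Lemma cexp_expansion (e : R) : 0 < e ->
  exists2 d : R, 0 < d & forall h, cabs h < d ->
    cabs (cexp h - 1 - h) <= e * cabs h.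
Proof.
(* The real part of the error is at most [4 k |h|] and the imaginary part at most [5 k |h|], hence
   the 9. *)
move=> e0; have [k [k0 k1 ke]] : exists k, [/\ 0 < k, k <= 1 & k <= e / 9].
  exists (Num.min 1 (e / 9)).
  by split; rewrite ?lt_min ?ge_min ?ltr01 ?divr_gt0 ?lexx ?orbT.
have [d1 d10 H1] := near0_ball (is_derive_near (is_derive_expR 0) k0).
have [d2 d20 H2] := near0_ball (is_derive_near (is_derive_cos 0) k0).
have [d3 d30 H3] := near0_ball (is_derive_near (is_derive_sin 0) k0).
pose d := Num.min (Num.min d1 d2) (Num.min d3 k).
exists d => [|h hd]; first by rewrite /d !lt_min d10 d20 d30 k0.
have [] : [/\ cabs h < d1, cabs h < d2, cabs h < d3 & cabs h < k].
  by move: hd; rewrite /d !lt_min => /andP[/andP[-> ->] /andP[-> ->]].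
set a := cabs h => hd1 hd2 hd3 hk.
have Reh := Re_le_cabs h; have Imh := Im_le_cabs h.
rewrite -/a in Reh Imh.
set x := Re h in Reh *; set y := Im h in Imh *.
have := H1 x (le_lt_trans Reh hd1); rewrite addr0 expR0 mul1r => E1.
have := H2 y (le_lt_trans Imh hd2); rewrite addr0 cos0 sin0 oppr0 mul0r subr0 => E2.
have := H3 y (le_lt_trans Imh hd3); rewrite addr0 cos0 sin0 subr0 mul1r => E3.
have a0 : 0 <= a := cabs_ge0 h.
have F1 : `|expR x - 1 - x| <= k * a by rewrite (le_trans E1)// ler_pM2l.
have F2 : `|cos y - 1| <= k * a by rewrite (le_trans E2)// ler_pM2l.
have F3 : `|sin y - y| <= k * a by rewrite (le_trans E3)// ler_pM2l.
have xk : `|x| <= k by rewrite (le_trans Reh)// ltW.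
have ex1 : `|expR x - 1| <= 2 * k.
  rewrite -(subrK x (expR x - 1)) (le_trans (ler_normD _ _))//.
  have : k * a <= k by rewrite -[leRHS]mulr1 ler_pM2l// (le_trans (ltW hk)).
  by lra.
have ex3 : `|expR x| <= 3.
  by rewrite -(subrK 1 (expR x)) (le_trans (ler_normD _ _))// normr1; lra.
apply: (le_trans (cabs_le_ReIm _)).
rewrite !cReD !cImD !cReN !cImN /= -/x -/y.
have -> : expR x * cos y - 1 - x = (expR x - 1 - x) + expR x * (cos y - 1) by ring.
have -> : expR x * sin y - 0 - y = expR x * (sin y - y) + (expR x - 1) * y by ring.
have G1 := ler_normD (expR x - 1 - x) (expR x * (cos y - 1)).
have G2 := ler_normD (expR x * (sin y - y)) ((expR x - 1) * y).
rewrite !normrM in G1 G2.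
have P1 : `|expR x| * `|cos y - 1| <= 3 * (k * a) by rewrite ler_pM.
have P2 : `|expR x| * `|sin y - y| <= 3 * (k * a) by rewrite ler_pM.
have P3 : `|expR x - 1| * `|y| <= (2 * k) * a by rewrite ler_pM.
have : k * a <= e / 9 * a by rewrite ler_wpM2r.
lra.
Qed.

Lemma gt0_real_complex (e : R[i]) : 0 < e -> exists2 r : R, 0 < r & e = r%:C.
Proof.
by case: e => r i; rewrite ltcE /= => /andP[/eqP -> r0]; exists r.
Qed.

Lemma continuous_Re : continuous (@complex.Re R : R[i]^o -> R).
Proof.
move=> z; apply/(@cvgrPdist_lt _ _ _ (nbhs z) _) => e e0; near=> w.
rewrite -cReN -cReD (le_lt_trans (Re_le_cabs _))// -ltcR.
near: w; apply: (@cvgr_dist_lt R[i] (R[i]^o) _ (nbhs z) _ id z) => //.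
by rewrite ltcR.
Unshelve. all: by end_near. Qed.

Lemma continuous_Im : continuous (@complex.Im R : R[i]^o -> R).
Proof.
move=> z; apply/(@cvgrPdist_lt _ _ _ (nbhs z) _) => e e0; near=> w.
rewrite -cImN -cImD (le_lt_trans (Im_le_cabs _))// -ltcR.
near: w; apply: (@cvgr_dist_lt R[i] (R[i]^o) _ (nbhs z) _ id z) => //.
by rewrite ltcR.
Unshelve. all: by end_near. Qed.

(** Little-o over [R[i]] quantifies over positive elements of [R[i]]; these have zero imaginary
    part, so real [e] suffice. *)
Lemma differentiable_of_expansion (V : normedModType R[i]) (f : V -> R[i]^o)
    (df : {linear V -> R[i]^o}) (p : V) :
  continuous df ->
  (forall e : R, 0 < e ->
     \forall h \near (0 : V), `|f (h + p) - f p - df h| <= e%:C * `|h|) ->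
  differentiable f p.
Proof.
move=> dfc H.
have E : f \o shift p = cst (f p) + df +o_ 0 id.
  apply/eqaddoP => _ /posnumP[e].
  have [r r0 er] := gt0_real_complex (gt0 e).
  near=> h; rewrite er /= opprD addrA; near: h; exact: H.
by apply/diff_locallyP; rewrite (diff_unique dfc E).
Unshelve. all: by end_near. Qed.

(** The addition formula reduces the expansion at [z] to [cexp z] times the expansion at 0. *)
Lemma differentiable_cexp z :
  differentiable (@cexp R : R[i]^o -> R[i]^o) (z : R[i]^o).
Proof.
pose df : {linear R[i]^o -> R[i]^o} := ( *:%R (cexp z : R[i]^o)).
apply: (@differentiable_of_expansion _ _ df) => [w|e e0].
  exact: scaler_continuous.
pose c := cabs (cexp z).
have c0 : 0 < c by rewrite cabs_gt0// cexp_neq0.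
have [d d0 H] := cexp_expansion (divr_gt0 e0 c0).
apply/nbhs_norm0P; exists d%:C; first by rewrite /= ltcR.
move=> h /=; rewrite normC_cabs ltcR => hd.
have -> : cexp (h + z) - cexp z - cexp z *: h = cexp z * (cexp h - 1 - h).
  by rewrite cexpD /GRing.scale /= ; ring.
rewrite !normC_cabs -rmorphM lecR cabsM -/c.
rewrite (le_trans (ler_wpM2l (ltW c0) (H _ hd)))//.
by rewrite mulrA mulrCA divff ?mulr1// gt_eqF.
Qed.

End ComplexDifferentiability.

(** * Holomorphy *)

Section WormLog.
Local Open Scope complex_scope.
Context {R : realType}.
Implicit Types (z p : C2 R) (mu : R).

(* The number in the disk [|zeta - 1| < 1] whose principal logarithm enters [L]. *)
Definition worm_zeta z : R[i] := (z.1 : R[i]) * cexp (- 'i * (logsq z.2)%:C).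

Lemma cexp_Ni (t : R) : cexp (- 'i * t%:C) = cos t -i* sin t.
Proof. by rewrite mulNr -mulrN -rmorphN cexp_i cosN sinN. Qed.

Lemma Re_worm_zeta z : Re (worm_zeta z) =
  Re z.1 * cos (logsq z.2) + Im z.1 * sin (logsq z.2).
Proof. by rewrite /worm_zeta cexp_Ni cReM /= mulrN opprK. Qed.

Lemma Im_worm_zeta z : Im (worm_zeta z) =
  Im z.1 * cos (logsq z.2) - Re z.1 * sin (logsq z.2).
Proof. by rewrite /worm_zeta cexp_Ni cImM /= mulrN addrC. Qed.

Lemma cabs_worm_zeta z : cabs (worm_zeta z) = cabs (z.1 : R[i]).
Proof.
by rewrite cabsM cabs_cexp cReM /= oppr0 !mul0r mulr0 subr0 expR0 mulr1.
Qed.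

Lemma worm_zetaK z : worm_zeta z * cexp ('i * (logsq z.2)%:C) = z.1.
Proof. by rewrite /worm_zeta -mulrA -cexpD mulNr addNr cexp0 mulr1. Qed.

Lemma Re_worm_L z : Re (worm_L z) = ln (cabs (z.1 : R[i])).
Proof.
rewrite /worm_L cReD -/(worm_zeta z) cReM /= !mul0r mul1r subr0 addr0.
by rewrite cabs_worm_zeta.
Qed.

Lemma Im_worm_L z : Im (worm_L z) = carg (worm_zeta z) + logsq z.2.
Proof. by rewrite /worm_L cImD -/(worm_zeta z) cImM /= mul0r mul1r add0r. Qed.

Lemma cexp_worm_L z : (z.1 : R[i]) != 0 -> cexp (worm_L z) = z.1.
Proof.
move=> z0; rewrite /worm_L cexpD -/(worm_zeta z) clogK ?worm_zetaK//.
by rewrite mulf_neq0// cexp_neq0.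
Qed.

Lemma Re_worm_zeta_neq0 z : 0 < Re (worm_zeta z) -> (z.1 : R[i]) != 0.
Proof.
apply: contraTneq => z0.
by rewrite Re_worm_zeta z0 /= !mul0r addr0 ltxx.
Qed.

Lemma worm_zetaB1 z :
  cabs (worm_zeta z - 1) = cabs ((z.1 : R[i]) - cexp ('i * (logsq z.2)%:C)).
Proof.
have c1 : cabs (cexp ('i * (logsq z.2)%:C)) = 1.
  by rewrite cabs_cexp cReM /= !mul0r mulr0 subr0 expR0.
by rewrite -[LHS]mulr1 -c1 -cabsM mulrBl worm_zetaK mul1r.
Qed.

(** The disk [|zeta - 1| < 1] lies in the right half-plane. There the argument is an arctangent and
    [z1] is nonzero. *)
Lemma worm_Re_zeta_gt0 mu z : truncated_worm mu z -> 0 < Re (worm_zeta z).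
Proof.
case=> _; rewrite -worm_zetaB1 => d1 _.
have : `|Re (worm_zeta z - 1)| < 1.
  rewrite (le_lt_trans (Re_le_cabs _))//.
  by rewrite -(@ltr_pXn2r _ 2) ?nnegrE ?cabs_ge0// expr1n.
by rewrite cReD cReN /= ltr_norml => /andP[+ _]; lra.
Qed.

Lemma worm_cabs_lt2 mu z : truncated_worm mu z -> cabs (z.1 : R[i]) < 2.
Proof.
case=> _; rewrite -worm_zetaB1 -cabs_worm_zeta => d1 _.
have d : cabs (worm_zeta z - 1) < 1.
  by rewrite -(@ltr_pXn2r _ 2) ?nnegrE ?cabs_ge0// expr1n.
rewrite -(subrK 1 (worm_zeta z)).
rewrite (le_lt_trans (cabsD _ _))// [cabs 1]Normc.normc1.
by move: d; lra.
Qed.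

Let cRe1 : continuous (fun z : C2 R => Re (z.1 : R[i])).
Proof.
by move=> z; apply: continuous_comp; [exact: cvg_fst|exact: continuous_Re].
Qed.

Let cIm1 : continuous (fun z : C2 R => Im (z.1 : R[i])).
Proof.
by move=> z; apply: continuous_comp; [exact: cvg_fst|exact: continuous_Im].
Qed.

Let cRe2 : continuous (fun z : C2 R => Re (z.2 : R[i])).
Proof.
by move=> z; apply: continuous_comp; [exact: cvg_snd|exact: continuous_Re].
Qed.

Let cIm2 : continuous (fun z : C2 R => Im (z.2 : R[i])).
Proof.
by move=> z; apply: continuous_comp; [exact: cvg_snd|exact: continuous_Im].
Qed.

Lemma continuous_logsq p : (p.2 : R[i]) != 0 ->
  (fun z : C2 R => logsq z.2) @ p --> logsq p.2.
Proof.
move=> p0; rewrite /logsq.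
under eq_fun do rewrite sqr_cabs.
rewrite sqr_cabs; apply: continuous_cvg.
  by apply: continuous_ln; rewrite -sqr_cabs exprn_gt0// cabs_gt0.
by apply: cvgD; rewrite expr2; under eq_fun do rewrite expr2; apply: cvgM;
  first [exact: cRe2|exact: cIm2].
Qed.

Lemma continuous_Re_worm_zeta p : (p.2 : R[i]) != 0 ->
  (fun z : C2 R => Re (worm_zeta z)) @ p --> Re (worm_zeta p).
Proof.
move=> p0; under eq_fun do rewrite Re_worm_zeta.
rewrite Re_worm_zeta; have c := continuous_logsq p0.
apply: cvgD; apply: cvgM.
- exact: cRe1.
- by apply: continuous_cvg => //; exact: continuous_cos.
- exact: cIm1.
- by apply: continuous_cvg => //; exact: continuous_sin.
Qed.

Lemma continuous_Im_worm_zeta p : (p.2 : R[i]) != 0 ->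
  (fun z : C2 R => Im (worm_zeta z)) @ p --> Im (worm_zeta p).
Proof.
move=> p0; under eq_fun do rewrite Im_worm_zeta.
rewrite Im_worm_zeta; have c := continuous_logsq p0.
apply: cvgB; apply: cvgM.
- exact: cIm1.
- by apply: continuous_cvg => //; exact: continuous_cos.
- exact: cRe1.
- by apply: continuous_cvg => //; exact: continuous_sin.
Qed.

Lemma continuous_Re_worm_L p : (p.1 : R[i]) != 0 ->
  (fun z : C2 R => Re (worm_L z)) @ p --> Re (worm_L p).
Proof.
move=> p0; under eq_fun do rewrite Re_worm_L.
rewrite Re_worm_L; apply: continuous_cvg.
  by apply: continuous_ln; rewrite cabs_gt0.
have e (z : R[i]) : cabs z = Num.sqrt (Re z ^+ 2 + Im z ^+ 2) by case: z.
under eq_fun do rewrite e.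
rewrite e; apply: continuous_cvg; first exact: sqrt_continuous.
by apply: cvgD; rewrite expr2; under eq_fun do rewrite expr2; apply: cvgM;
  first [exact: cRe1|exact: cIm1].
Qed.

Lemma near_Re_worm_zeta_gt0 p : (p.2 : R[i]) != 0 -> 0 < Re (worm_zeta p) ->
  \forall z \near p, 0 < Re (worm_zeta z).
Proof.
move=> p20 p10; apply: (@cvgr_gt _ _ (nbhs p)); last exact: p10.
exact: continuous_Re_worm_zeta.
Qed.

(** The condition [Re zeta > 0] is open, so near [p] the argument is given by the arctangent formula
    and cannot jump. *)
Lemma continuous_Im_worm_L p : (p.2 : R[i]) != 0 -> 0 < Re (worm_zeta p) ->
  (fun z : C2 R => Im (worm_L z)) @ p --> Im (worm_L p).
Proof.
move=> p20 p10.
have c : (fun z : C2 R =>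
      atan (Im (worm_zeta z) / Re (worm_zeta z)) + logsq z.2) @ p -->
    atan (Im (worm_zeta p) / Re (worm_zeta p)) + logsq p.2.
  apply: cvgD; last exact: continuous_logsq.
  apply: continuous_cvg; first exact: continuous_atan.
  apply: cvgM; first exact: continuous_Im_worm_zeta.
  by apply: cvgV; [rewrite gt_eqF|exact: continuous_Re_worm_zeta].
rewrite Im_worm_L carg_atan//; apply: cvg_trans c.
apply: near_eq_cvg; near=> z; rewrite Im_worm_L carg_atan//.
by near: z; exact: near_Re_worm_zeta_gt0.
Unshelve. all: by end_near. Qed.

End WormLog.

(** * Differentiability of [L], of the powers of [z2] and of [H] *)

Section WormHolomorphic.
Local Open Scope complex_scope.
Context {R : realType}.
Implicit Types (z p : C2 R) (mu : R).

(* [u = L z - L p] tends to [0] and [cexp u = z1 / p1], so the expansion of [cexp]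
   at [0] gives [u = z1 / p1 - 1 + o(z1 - p1)]. *)
Lemma differentiable_worm_L p : (p.2 : R[i]) != 0 -> 0 < Re (worm_zeta p) ->
  differentiable (worm_L : C2 R -> R[i]^o) p.
Proof.
move=> p20 zp; have p10 := Re_worm_zeta_neq0 zp.
pose df : {linear C2 R -> R[i]^o} :=
  ( *:%R (p.1^-1 : R[i]) : R[i]^o -> R[i]^o) \o fst.
apply: (@differentiable_of_expansion _ _ _ df) => [w|e e0].
  apply: continuous_comp; [exact: cvg_fst|exact: scaler_continuous].
pose a := cabs (p.1 : R[i]).
have a0 : 0 < a by rewrite cabs_gt0.
(* With [w = z1 / p1 - 1], the bound [k <= 1 / 2] gives [|u| <= 2 |w|], and [k <= e a / 2] then
   bounds the error [k |u|] by [e a |w| = e |z1 - p1|]. *)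
have [k [k0 k1 ke]] : exists k, [/\ 0 < k, k <= 1 / 2 & k <= e * a / 2].
  exists (Num.min (1 / 2) (e * a / 2)).
  by split; rewrite ?lt_min ?ge_min ?divr_gt0 ?mulr_gt0 ?lexx ?orbT.
have [d d0 H] := cexp_expansion k0.
have nearu : \forall z \near p, cabs (worm_L z - worm_L p) < d.
  near=> z; rewrite (le_lt_trans (cabs_le_ReIm _))//.
  rewrite cReD cImD cReN cImN (splitr d) ltrD// distrC; near: z.
    apply: (@cvgr_dist_lt _ _ _ (nbhs p) _ (fun z => Re (worm_L z))).
      exact: continuous_Re_worm_L.
    by rewrite divr_gt0.
  apply: (@cvgr_dist_lt _ _ _ (nbhs p) _ (fun z => Im (worm_L z))).
    exact: continuous_Im_worm_L.
  by rewrite divr_gt0.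
have nearp : \forall z \near p,
    cabs (worm_L z - worm_L p - (p.1 : R[i])^-1 * ((z.1 : R[i]) - p.1)) <=
    e * cabs ((z.1 : R[i]) - p.1).
  near=> z.
  have zz : 0 < Re (worm_zeta z) by near: z; exact: near_Re_worm_zeta_gt0.
  have z10 := Re_worm_zeta_neq0 zz.
  have ud : cabs (worm_L z - worm_L p) < d by near: z; exact: nearu.
  set u := worm_L z - worm_L p in ud *.
  set w := (p.1 : R[i])^-1 * ((z.1 : R[i]) - p.1).
  have uw : cexp u - 1 = w.
    by rewrite /u cexpD cexpN !cexp_worm_L// /w mulrBr mulVf// mulrC.
  have := H _ ud; rewrite uw -(cabsN (w - u)) opprB => uwk.
  have cw : cabs w = cabs ((z.1 : R[i]) - p.1) / a by rewrite cabsM cabsV mulrC.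
  have uw2 : cabs u <= 2 * cabs w.
    have := cabsD (u - w) w; rewrite subrK => t1.
    have : k * cabs u <= 1 / 2 * cabs u by rewrite ler_wpM2r// cabs_ge0.
    by lra.
  rewrite (le_trans uwk)//.
  have : k * cabs u <= (e * a / 2) * (2 * cabs w).
    by rewrite ler_pM// ?cabs_ge0// ltW.
  move=> /le_trans; apply; rewrite cw.
  suff -> : e * a / 2 * (2 * (cabs ((z.1 : R[i]) - p.1) / a)) =
            e * cabs ((z.1 : R[i]) - p.1) by [].
  by field; rewrite gt_eqF.
have nearh : \forall h \near (0 : C2 R),
    cabs (worm_L (h + p) - worm_L p - (p.1 : R[i])^-1 * ((h + p).1 - p.1)) <=
    e * cabs ((h + p).1 - p.1 : R[i]).
  move: nearp; rewrite (near_shift (0 : C2 R) p) subr0; exact.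
near=> h.
apply: (@le_trans _ _ ((e * cabs (h.1 : R[i]))%:C)).
  have := near nearh h; rewrite /= addrK => /(_ _).
  by rewrite -lecR; apply.
have -> : (e * cabs (h.1 : R[i]))%:C = e%:C * `|h.1 : R[i]|.
  by rewrite normC_cabs -rmorphM.
rewrite ler_wpM2l//; first by rewrite ler0c ltW.
(* The order on [R[i]] is partial, so comparing [|h.1|] with the maximum norm requires that the two
   norms be comparable; both are real. *)
rewrite prod_normE comparable_le_max ?lexx//.
by rewrite real_comparable.
Unshelve. all: by end_near. Qed.

Lemma differentiable_exprz_snd p (j : int) : (p.2 : R[i]) != 0 ->
  differentiable (fun z : C2 R => (z.2 : R[i]) ^ j : R[i]^o) p.
Proof.
move=> p20; have dsnd : differentiable (snd : C2 R -> R[i]^o) p.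
  by apply: linear_differentiable => x; exact: cvg_snd.
have dX n : differentiable (fun z : C2 R => (z.2 : R[i]) ^+ n : R[i]^o) p.
  case: n => [|n].
    exact: (@differentiable_cst R[i] (C2 R) R[i]^o (1 : R[i]^o) p).
  by have := @differentiableX R[i] (C2 R) snd n p dsnd; rewrite exprfctE.
case: j => n; first exact: dX.
apply: (@differentiableV R[i] (C2 R) (fun z : C2 R => (z.2 : R[i]) ^+ n.+1)).
  exact: dX.
by rewrite expf_neq0.
Qed.

Lemma holomorphic_worm_H mu c0 l j :
  holomorphic_on (truncated_worm mu) (worm_H mu c0 l j : C2 R -> R[i]^o).
Proof.
move=> p Wp; have zp := worm_Re_zeta_gt0 Wp; have [p20 _ _] := Wp.
rewrite /worm_H /worm_E; set eta := (_ + _ : R[i]).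
apply: (@differentiableM R[i] (C2 R) (fun z => cexp (eta * worm_L z))
  (fun z => (z.2 : R[i]) ^ j)).
  have dL : differentiable (fun z => eta *: (worm_L z : R[i]^o) : R[i]^o) p.
    apply: (@differentiableZ R[i] (C2 R) R[i]^o worm_L eta).
    exact: differentiable_worm_L.
  exact: (differentiable_comp dL (differentiable_cexp _)).
exact: differentiable_exprz_snd.
Qed.

End WormHolomorphic.

(** * Square integrability *)

Section ComplexMeasurable.
Local Open Scope complex_scope.
Context {d : measure_display} {T : measurableType d} {R : realType}.
Implicit Types (D : set T) (f g : T -> R[i]).

Lemma measurable_set_lt (f g : T -> R) :
  measurable_fun setT f -> measurable_fun setT g ->
  measurable [set x | f x < g x].
Proof.
move=> mf mg; rewrite -[X in measurable X]setTI.
exact: (measurable_fun_ltr mf mg measurableT (I : measurable [set true])).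
Qed.

Lemma measurable_set_le (f g : T -> R) :
  measurable_fun setT f -> measurable_fun setT g ->
  measurable [set x | f x <= g x].
Proof.
move=> mf mg; rewrite -[X in measurable X]setTI.
exact: (measurable_fun_ler mf mg measurableT (I : measurable [set true])).
Qed.

(** For positive values the inverse is [exp (- ln f)], a composition of measurable functions. *)
Lemma measurable_funV_gt0 D (f : T -> R) : measurable_fun D f ->
  (forall x, D x -> 0 < f x) -> measurable_fun D (fun x => (f x)^-1).
Proof.
move=> mf f0; apply: (@eq_measurable_fun _ _ _ _ _ (fun x => expR (- ln (f x)))).
  by move=> x /set_mem Dx; rewrite expRN lnK// posrE f0.
apply: measurableT_comp; first exact: measurable_expR.
by apply: measurable_funN; apply: measurableT_comp => //; exact: measurable_ln.
Qed.

(** Stated by components because complex integrals are taken by components. *)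
Definition cmeasurable D f : Prop :=
  measurable_fun D (fun x => Re (f x)) /\ measurable_fun D (fun x => Im (f x)).

Lemma cmeasurable_eq D f g :
  (forall x, D x -> f x = g x) -> cmeasurable D f -> cmeasurable D g.
Proof.
move=> fg [mr mi]; split; [apply: eq_measurable_fun mr|apply: eq_measurable_fun mi];
  by move=> x /set_mem /fg ->.
Qed.

Lemma cmeasurable_cst D (c : R[i]) : cmeasurable D (fun=> c).
Proof. by split; exact: measurable_cst. Qed.

Lemma cmeasurableM D f g :
  cmeasurable D f -> cmeasurable D g -> cmeasurable D (fun x => f x * g x).
Proof.
move=> [fr fi] [gr gi]; split.
  under eq_fun do rewrite cReM.
  by apply: measurable_funB; exact: measurable_funM.
under eq_fun do rewrite cImM.
by apply: measurable_funD; exact: measurable_funM.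
Qed.

Lemma cmeasurableX D f n : cmeasurable D f -> cmeasurable D (fun x => f x ^+ n).
Proof.
move=> mf; elim: n => [|n ih]; first exact: cmeasurable_cst.
by under eq_fun do rewrite exprS; exact: cmeasurableM.
Qed.

Lemma cmeasurable_conj D f : cmeasurable D f -> cmeasurable D (fun x => conjc (f x)).
Proof.
move=> [fr fi]; split.
  by apply: eq_measurable_fun fr => x _; case: (f x).
apply: (@eq_measurable_fun _ _ _ _ _ (fun x => - Im (f x))).
  by move=> x _; case: (f x).
exact: measurable_funN.
Qed.

Lemma cmeasurable_cabs D f : cmeasurable D f -> measurable_fun D (fun x => cabs (f x)).
Proof.
move=> [fr fi].
have e (z : R[i]) : cabs z = Num.sqrt (Re z * Re z + Im z * Im z).
  by rewrite -!expr2; case: z.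
under eq_fun do rewrite e.
apply: (measurableT_comp (continuous_measurable_fun (@sqrt_continuous R))).
by apply: measurable_funD; exact: measurable_funM.
Qed.

Lemma cmeasurableV D f : cmeasurable D f -> (forall x, D x -> f x != 0) ->
  cmeasurable D (fun x => (f x)^-1).
Proof.
move=> mf f0; have [fr fi] := mf.
have mV : measurable_fun D (fun x => (cabs (f x) ^+ 2)^-1).
  apply: measurable_funV_gt0 => [|x Dx].
    by apply: measurable_funX; exact: cmeasurable_cabs.
  by rewrite exprn_gt0// cabs_gt0// f0.
apply: (@cmeasurable_eq _ (fun x => (Re (f x) * (cabs (f x) ^+ 2)^-1) +i*
   - (Im (f x) * (cabs (f x) ^+ 2)^-1))).
  by move=> x _; rewrite sqr_cabs; case: (f x) => a b.
by split; [exact: measurable_funM|apply: measurable_funN; exact: measurable_funM].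
Qed.

Lemma cmeasurableXz D f (j : int) : cmeasurable D f -> (forall x, D x -> f x != 0) ->
  cmeasurable D (fun x => f x ^ j).
Proof.
move=> mf f0; case: j => n; first exact: cmeasurableX.
apply: cmeasurableV; first exact: cmeasurableX.
by move=> x Dx; rewrite expf_neq0// f0.
Qed.

Lemma cmeasurable_cexp D f : cmeasurable D f -> cmeasurable D (fun x => cexp (f x)).
Proof.
move=> [fr fi]; split; rewrite /cexp /=; apply: measurable_funM.
- by apply: measurableT_comp => //; exact: measurable_expR.
- apply: measurableT_comp => //.
  by apply: continuous_measurable_fun; exact: continuous_cos.
- by apply: measurableT_comp => //; exact: measurable_expR.
- apply: measurableT_comp => //.
  by apply: continuous_measurable_fun; exact: continuous_sin.
Qed.

End ComplexMeasurable.

(** * Measurability of the domain and of [H] in real coordinates *)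

Section WormMeasurable.
Local Open Scope complex_scope.
Context {R : realType}.
Implicit Types (mu : R) (l : nat) (j : int).

Local Notation R2 := (measurableTypeR R * measurableTypeR R)%type.
Local Notation R4 := (R2 * R2)%type.

Definition worm4 mu : set R4 := (@of_real4 R) @^-1` truncated_worm mu.

Lemma cmeasurable_fst4 : cmeasurable setT (fun p : R4 => ((of_real4 p).1 : R[i])).
Proof.
by split; [exact: (measurableT_comp measurable_fst measurable_fst)|
           exact: (measurableT_comp measurable_snd measurable_fst)].
Qed.

Lemma cmeasurable_snd4 : cmeasurable setT (fun p : R4 => ((of_real4 p).2 : R[i])).
Proof.
by split; [exact: (measurableT_comp measurable_fst measurable_snd)|
           exact: (measurableT_comp measurable_snd measurable_snd)].
Qed.

Lemma measurable_logsq4 :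
  measurable_fun setT (fun p : R4 => logsq (of_real4 p).2).
Proof.
apply: measurableT_comp; first exact: measurable_ln.
by apply: measurable_funX; exact: cmeasurable_cabs cmeasurable_snd4.
Qed.

Lemma cmeasurable_zeta4 : cmeasurable setT (fun p : R4 => worm_zeta (of_real4 p)).
Proof.
apply: cmeasurableM; first exact: cmeasurable_fst4.
apply: cmeasurable_cexp; apply: cmeasurableM; first exact: cmeasurable_cst.
by split => /=; [exact: measurable_logsq4|exact: measurable_cst].
Qed.

(** In terms of [zeta] and [log |z2|^2] the changes of variables become transparent: both fix
    [zeta], and [log |z2|^2] is fixed or shifted. *)
Lemma worm4P mu (p : R4) : worm4 mu p <->
  [/\ ((of_real4 p).2 : R[i]) != 0, cabs (worm_zeta (of_real4 p) - 1) ^+ 2 < 1 &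
    - mu < logsq (of_real4 p).2 < mu].
Proof.
by rewrite /worm4 /preimage /mkset /truncated_worm /mkset -worm_zetaB1 ltr_norml.
Qed.

Lemma measurable_worm4 mu : measurable (worm4 mu).
Proof.
have -> : worm4 mu = [set p : R4 | 0 < cabs ((of_real4 p).2 : R[i])] `&`
   ([set p | cabs (worm_zeta (of_real4 p) - 1) ^+ 2 < 1] `&`
    ([set p | - mu < logsq (of_real4 p).2] `&`
     [set p | logsq (of_real4 p).2 < mu])).
  apply/seteqP; split=> p.
    move=> /worm4P[p0 p1 /andP[p2 p3]]; split=> //.
    by rewrite /mkset cabs_gt0.
  case=> p0 [p1 [p2 p3]]; apply/worm4P; split=> //; last exact/andP.
  by apply: contraTneq p0 => ->; rewrite [cabs _]Normc.normc0 ltxx.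
apply: measurableI.
  by apply: measurable_set_lt => //; exact: cmeasurable_cabs cmeasurable_snd4.
apply: measurableI; last first.
  by apply: measurableI; apply: measurable_set_lt => //; exact: measurable_logsq4.
apply: measurable_set_lt => //; apply: measurable_funX; apply: cmeasurable_cabs.
have [zr zi] := cmeasurable_zeta4; split.
  by under eq_fun do rewrite cReD cReN /=; exact: measurable_funB.
by under eq_fun do rewrite cImD cImN /=; exact: measurable_funB.
Qed.

Lemma cmeasurable_worm_L mu :
  cmeasurable (worm4 mu) (fun p : R4 => worm_L (of_real4 p)).
Proof.
split.
  apply: measurable_funTS; under eq_fun do rewrite Re_worm_L.
  apply: measurableT_comp; first exact: measurable_ln.
  exact: cmeasurable_cabs cmeasurable_fst4.
apply: (@eq_measurable_fun _ _ _ _ _ (fun p : R4 =>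
  atan (Im (worm_zeta (of_real4 p)) / Re (worm_zeta (of_real4 p))) +
  logsq (of_real4 p).2)).
  by move=> p /set_mem wp; rewrite Im_worm_L carg_atan//; exact: worm_Re_zeta_gt0 wp.
apply: measurable_funD; last by apply: measurable_funTS; exact: measurable_logsq4.
have [zr zi] := cmeasurable_zeta4.
apply: measurableT_comp.
  by apply: continuous_measurable_fun => x; exact: continuous_atan.
apply: measurable_funM; first exact: measurable_funTS.
apply: measurable_funV_gt0; first exact: measurable_funTS.
by move=> p; exact: worm_Re_zeta_gt0.
Qed.

Lemma cmeasurable_worm_H mu (c0 : R) l j :
  cmeasurable (worm4 mu) (fun p : R4 => worm_H mu c0 l j (of_real4 p) : R[i]).
Proof.
apply: cmeasurableM.
  apply: cmeasurable_cexp; apply: cmeasurableM; first exact: cmeasurable_cst.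
  exact: cmeasurable_worm_L.
apply: cmeasurableXz; last by move=> p [].
by have [fr fi] := cmeasurable_snd4; split; exact: measurable_funTS.
Qed.

End WormMeasurable.

Lemma nneseries_geometric_lty {R : realType} (u : nat -> \bar R) (C q : R) :
  0 <= C -> 0 <= q < 1 ->
  (forall n, 0 <= u n)%E -> (forall n, u n <= (C * q ^+ n)%:E)%E ->
  (\sum_(n <oo) u n < +oo)%E.
Proof.
move=> C0 /andP[q0 q1] u0 uC.
apply: (@le_lt_trans _ _ (C / (1 - q))%:E); last exact: ltry.
apply: lime_le; first by apply: is_cvg_nneseries.
have q10 : 0 < 1 - q by rewrite subr_gt0.
have h n : (\sum_(0 <= k < n) u k <= (C * (1 - q ^+ n) / (1 - q))%:E)%E.
  elim: n => [|n ih]; first by rewrite big_geq// expr0 subrr mulr0 mul0r.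
  rewrite big_nat_recr//= (le_trans (leeD ih (uC n)))// -EFinD lee_fin.
  rewrite le_eqVlt; apply/orP; left; apply/eqP; rewrite exprS.
  by field; rewrite gt_eqF.
near=> n; apply: (le_trans (h n)); rewrite lee_fin ler_pM2r ?invr_gt0//.
by rewrite -[leRHS]mulr1 ler_wpM2l// gerBl exprn_ge0.
Unshelve. all: by end_near. Qed.

(** * Integrability of the powers of [|z1|] *)

Section WormIntegrable.
Local Open Scope complex_scope.
Context {R : realType}.
Implicit Types (mu : R) (l : nat) (j : int).

Local Notation R2 := (measurableTypeR R * measurableTypeR R)%type.
Local Notation R4 := (R2 * R2)%type.
Local Notation leb := (@lebesgue_measure R).
Local Notation leb2 := (@lebesgue2 R).
Local Notation leb4 := (@lebesgue4 R).

Definition box2 (r : R) : set R2 := `[- r, r]%classic `*` `[- r, r]%classic.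

Lemma measurable_box2 r : measurable (box2 r).
Proof. exact: measurableX. Qed.

Lemma lebesgue2_box2 r : 0 < r -> leb2 (box2 r) = ((2 * r) ^+ 2)%:E.
Proof.
move=> r0; rewrite [LHS]product_measure1E//.
have e : leb `[- r, r]%classic = (2 * r)%:E.
  rewrite [LHS](lebesgue_measure_itv `[- r, r]) /= lte_fin ifT; last by lra.
  by rewrite -EFinD; congr EFin; ring.
by rewrite expr2 EFinM; congr (_ * _)%E; exact: e.
Qed.

Lemma box2_cabs (p : R2) (r : R) : cabs ((p.1 : R) +i* (p.2 : R)) <= r -> box2 r p.
Proof.
move=> pr; split; rewrite /= in_itv /= -ler_norml (le_trans _ pr)//.
  exact: (Re_le_cabs ((p.1 : R) +i* (p.2 : R))).
exact: (Im_le_cabs ((p.1 : R) +i* (p.2 : R))).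
Qed.

(** Here [|z1| < 2 < e]. Hence [1 - ln |z1|] is positive and its integer part can index the
    shells. *)
Lemma worm_ln_lt1 mu (z : C2 R) : truncated_worm mu z -> ln (cabs (z.1 : R[i])) < 1.
Proof.
move=> wz; have z10 := Re_worm_zeta_neq0 (worm_Re_zeta_gt0 wz).
rewrite -ltr_expR lnK ?posrE ?cabs_gt0// (lt_trans (worm_cabs_lt2 wz))//.
exact: expR_gt1Dx (oner_neq0 R).
Qed.

Lemma worm_norm_ln_cabs2 mu (z : C2 R) : truncated_worm mu z ->
  `|ln (cabs (z.2 : R[i]))| <= mu.
Proof.
case=> z20 _; have c0 := cabs_gt0 z20.
rewrite /logsq lnXn// normrMn => h; apply: ltW; apply: le_lt_trans h.
by rewrite mulr2n lerDl.
Qed.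

Lemma worm_cabs2_le mu (z : C2 R) : truncated_worm mu z ->
  cabs (z.2 : R[i]) <= expR mu.
Proof.
move=> wz; have [z20 _ _] := wz.
rewrite -[leLHS]lnK ?posrE ?cabs_gt0// ler_expR.
exact: le_trans (ler_norm _) (worm_norm_ln_cabs2 wz).
Qed.

Let lnr (p : R4) : R := ln (cabs ((of_real4 p).1 : R[i])).

Let measurable_lnr : measurable_fun setT lnr.
Proof.
apply: measurableT_comp; first exact: measurable_ln.
exact: cmeasurable_cabs cmeasurable_fst4.
Qed.

(* On [shell mu n], [|z1|] is about [e^-n], so [|z1|^b] integrates to at most a
   constant times [e^(-(b+2)n)]. *)
Let shell mu (n : nat) : set R4 :=
  worm4 mu `&` [set p | n%:R <= 1 - lnr p] `&` [set p | 1 - lnr p < n.+1%:R].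

Let measurable_shell mu n : measurable (shell mu n).
Proof.
have m1 : measurable_fun setT (fun p => 1 - lnr p) by exact: measurable_funB.
apply: measurableI; last exact: measurable_set_lt.
by apply: measurableI; [exact: measurable_worm4|exact: measurable_set_le].
Qed.

(** The shell lies in a product of two squares, since [|z1| <= e^(1 - n)] and [|z2| <= e^mu] on
    it. *)
Let lebesgue4_shell mu n :
  (leb4 (shell mu n) <= ((2 * expR (1 - n%:R)) ^+ 2 * (2 * expR mu) ^+ 2)%:E)%E.
Proof.
have mb : measurable (box2 (expR (1 - n%:R)) `*` box2 (expR mu)).
  by apply: measurableX; exact: measurable_box2.
apply: (@le_trans _ _ (leb4 (box2 (expR (1 - n%:R)) `*` box2 (expR mu)))).
  apply: le_measure; rewrite ?inE//.
  move=> p [[wp np] _]; split; apply: box2_cabs; last exact: worm_cabs2_le wp.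
  rewrite -[leLHS]lnK ?posrE ?ler_expR; last first.
    by rewrite cabs_gt0//; exact: Re_worm_zeta_neq0 (worm_Re_zeta_gt0 wp).
  by move: np; rewrite /lnr /=; lra.
rewrite /lebesgue4 product_measure1E; last 2 first.
- exact: measurable_box2.
- exact: measurable_box2.
by rewrite EFinM -!lebesgue2_box2 ?expR_gt0.
Qed.

Let worm4_shells mu : worm4 mu = \bigcup_n shell mu n.
Proof.
apply/seteqP; split=> p; last by case=> n _ [[]].
move=> wp; have t0 : 0 <= 1 - lnr p by rewrite subr_ge0 ltW// (worm_ln_lt1 wp).
by have /andP[h1 h2] := truncn_itv t0; exists (Num.truncn (1 - lnr p)).
Qed.

Let trivIset_shell mu : trivIset setT (shell mu).
Proof.
apply/trivIsetP => n m _ _ nm; apply/seteqP; split => // p.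
move=> [[[_ /= n1] n2] [[_ /= m1] m2]]; move/eqP: nm; apply.
apply/eqP; rewrite eqn_leq -ltnS -(ltr_nat R) (le_lt_trans n1 m2)/=.
by rewrite -ltnS -(ltr_nat R) (le_lt_trans m1 n2).
Qed.

(** The integrals over the shells are dominated by a geometric series of ratio [e^(-(b + 2))], which
    is less than 1 because [b > -2]. *)
Lemma integrable_worm_weight mu (b : R) : - 2 < b ->
  leb4.-integrable (worm4 mu)
    (fun p => (expR (b * ln (cabs ((of_real4 p).1 : R[i]))))%:E).
Proof.
move=> b2; pose f (p : R4) := (expR (b * lnr p))%:E.
have mf : measurable_fun setT f.
  apply/measurable_EFinP; apply: measurableT_comp; first exact: measurable_expR.
  exact: measurable_funM.
apply/integrableP; split; first exact: measurable_funTS mf.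
under eq_integral do rewrite gee0_abs ?lee_fin ?expR_ge0//.
rewrite -[X in (X < _)%E]/(\int[leb4]_(p in worm4 mu) f p)%E.
rewrite worm4_shells ge0_integral_bigcup//; last 2 first.
- exact: measurable_funTS.
- by move=> p _; rewrite lee_fin expR_ge0.
(* The factors independent of [n]: [e^|b|] comes from the weight, the rest from the volume of the
   box. *)
pose C := expR `|b| * ((2 * expR 1) ^+ 2 * (2 * expR mu) ^+ 2).
apply: (@nneseries_geometric_lty _ _ C (expR (- (b + 2)))).
- by rewrite /C !mulr_ge0 ?expR_ge0 ?sqr_ge0.
- by rewrite expR_ge0 expR_lt1; lra.
- by move=> n; apply: integral_ge0 => p _; rewrite lee_fin expR_ge0.
move=> n.
(* On the shell [0 < ln |z1| + n <= 1], hence [b ln |z1| <= |b| - b n] whatever the sign of [b]. *)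
have fb p : shell mu n p -> (f p <= (expR (`|b| - b * n%:R))%:E)%E.
  move=> [[_ /= h1] h2]; rewrite lee_fin ler_expR.
  set t := lnr p in h1 h2 *.
  have : b * (t + n%:R) <= `|b|.
    rewrite (le_trans (ler_norm _))// normrM -[leRHS]mulr1 ler_wpM2l//.
    by rewrite ler_norml; rewrite -natr1 in h2; apply/andP; split; lra.
  by rewrite mulrDr; lra.
have int_le : (\int[leb4]_(p in shell mu n) f p <=
    (expR (`|b| - b * n%:R))%:E * leb4 (shell mu n))%E.
  rewrite -integral_cst//; apply: ge0_le_integral => //.
    by move=> p _; rewrite lee_fin expR_ge0.
  exact: measurable_funTS.
apply: (le_trans int_le).
apply: (@le_trans _ _ ((expR (`|b| - b * n%:R))%:E *
    ((2 * expR (1 - n%:R)) ^+ 2 * (2 * expR mu) ^+ 2)%:E)%E).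
  by rewrite lee_wpmul2l ?lee_fin ?expR_ge0.
rewrite -EFinM lee_fin -expRM_natr.
suff -> : expR (`|b| - b * n%:R) * ((2 * expR (1 - n%:R)) ^+ 2 * (2 * expR mu) ^+ 2) =
  C * expR (- (b + 2) * n%:R) by [].
rewrite /C.
have -> : - (b + 2) * n%:R = - (b * n%:R) + (- n%:R + - n%:R) by ring.
by rewrite !expRD; ring.
Qed.

End WormIntegrable.

(** * Membership of [H] in the Bergman space *)

Section WormBergman.
Local Open Scope complex_scope.
Context {R : realType}.
Implicit Types (mu : R) (l : nat) (j : int).

Local Notation R2 := (measurableTypeR R * measurableTypeR R)%type.
Local Notation R4 := (R2 * R2)%type.
Local Notation leb4 := (@lebesgue4 R).

Lemma integrable_worm_le mu (f : R4 -> R) (b C : R) : - 2 < b ->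
  measurable_fun (worm4 mu) f ->
  (forall p, worm4 mu p ->
     `|f p| <= C * expR (b * ln (cabs ((of_real4 p).1 : R[i])))) ->
  leb4.-integrable (worm4 mu) (EFin \o f).
Proof.
move=> b2 mf fC; have mW := measurable_worm4 mu.
have := integrableZl mW C (integrable_worm_weight mu b2).
apply: le_integrable => //; first exact/measurable_EFinP.
move=> p wp; rewrite /= lee_fin (le_trans (fC p wp))//.
exact: ler_norm.
Qed.

Definition worm_eta mu (c0 : R) l j : R[i] :=
  (c0 + pi / (2 * mu) * l%:R) +i* ((j + 1)%:~R / 2).

Lemma worm_HE mu c0 l j (z : C2 R) :
  worm_H mu c0 l j z = cexp (worm_eta mu c0 l j * worm_L z) * (z.2 : R[i]) ^ j.
Proof.
have half : ((j + 1)%:~R / 2 : R[i]) = ((j + 1)%:~R / 2)%:C.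
  by rewrite rmorphM fmorphV rmorph_int rmorph_nat.
have E : (c0 + pi / (2 * mu) * l%:R)%:C + 'i * ((j + 1)%:~R / 2) =
    worm_eta mu c0 l j.
  rewrite half; apply/eqP; rewrite eq_complex cReD cImD cReM cImM /=.
  by rewrite !mul0r !mul1r subr0 addr0 !add0r !eqxx.
by rewrite /worm_H /worm_E E.
Qed.

(** All factors of [|H|] other than the power of [|z1|] are bounded: [|Im L|] is at most [pi + mu],
    and [|ln |z2||] at most [mu]. *)
Lemma cabs_worm_H_le mu c0 l j : exists C : R, forall z, truncated_worm mu z ->
  cabs (worm_H mu c0 l j z) <=
  C * expR ((c0 + pi / (2 * mu) * l%:R) * ln (cabs (z.1 : R[i]))).
Proof.
pose b : R := (j + 1)%:~R / 2.
exists (expR (`|b| * (pi + mu) + `|j%:~R| * mu)) => z wz.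
have [z20 _ th] := wz; have zz := worm_Re_zeta_gt0 wz.
rewrite worm_HE cabsM cabs_cexp cabs_exprz// cReM Re_worm_L Im_worm_L /= -/b.
set a := c0 + _; set t := ln (cabs z.1); set s := ln (cabs z.2).
rewrite -!expRD ler_expR.
have sm : `|s| <= mu := worm_norm_ln_cabs2 wz.
have js : j%:~R * s <= `|j%:~R| * mu.
  by rewrite (le_trans (ler_norm _))// normrM ler_wpM2l.
have argle : `|carg (worm_zeta z) + logsq z.2| <= pi + mu.
  rewrite (le_trans (ler_normD _ _))// lerD//; last exact: ltW.
  have /carg_itv /andP[c1 c2] : worm_zeta z != 0.
    by apply: contraTneq zz => ->; rewrite ltxx.
  by rewrite ler_norml c2 ltW.
have : `|b * (carg (worm_zeta z) + logsq z.2)| <= `|b| * (pi + mu).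
  by rewrite normrM ler_wpM2l.
by move=> /ler_normlP[]; lra.
Qed.

Lemma worm_exponent_gtN1 mu (c0 : R) l : 0 < mu -> -1 < c0 ->
  -1 < c0 + pi / (2 * mu) * l%:R.
Proof.
move=> mu0 c01; rewrite (lt_le_trans c01)// lerDl mulr_ge0// divr_ge0 ?pi_ge0//.
by rewrite mulr_ge0// ltW.
Qed.

(** The square of the modulus is dominated by [|z1|^(2 a)] with [a > -1], so the exponent lies in
    the integrable range [2 a > -2]. *)
Lemma bergman_worm_H mu c0 l j : 0 < mu -> -1 < c0 ->
  bergman (truncated_worm mu) (worm_H mu c0 l j).
Proof.
move=> mu0 c01; split; first exact: holomorphic_worm_H.
have [C HC] := cabs_worm_H_le mu c0 l j.
have a1 := worm_exponent_gtN1 l mu0 c01; set a := (c0 + _) in HC a1.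
apply: (@integrable_worm_le mu _ (2 * a) (C ^+ 2)).
- by lra.
- by apply: measurable_funX; apply: cmeasurable_cabs; exact: cmeasurable_worm_H.
move=> p wp; rewrite normrX ger0_norm ?cabs_ge0//.
rewrite -[2 * a * _]mulrA expRM_natl -exprMn lerXn2r ?nnegrE ?cabs_ge0//.
  exact: le_trans (cabs_ge0 _) (HC _ wp).
exact: HC.
Qed.

(** The exponents of [|z1|] add up, and two exponents above -1 have a sum above -2. *)
Lemma integrable_worm_HM mu c0 l j l' j' : 0 < mu -> -1 < c0 ->
  let F (p : R4) := (worm_H mu c0 l j (of_real4 p) : R[i]) *
      conjc (worm_H mu c0 l' j' (of_real4 p)) in
  leb4.-integrable (worm4 mu) (EFin \o (fun p => Re (F p))) /\
  leb4.-integrable (worm4 mu) (EFin \o (fun p => Im (F p))).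
Proof.
move=> mu0 c01 F.
have [C HC] := cabs_worm_H_le mu c0 l j.
have [C' HC'] := cabs_worm_H_le mu c0 l' j'.
have a1 := worm_exponent_gtN1 l mu0 c01; have a1' := worm_exponent_gtN1 l' mu0 c01.
set a := (c0 + _) in HC a1; set a' := (c0 + _) in HC' a1'.
have [mFr mFi] : cmeasurable (worm4 mu) F.
  apply: cmeasurableM; first exact: cmeasurable_worm_H.
  by apply: cmeasurable_conj; exact: cmeasurable_worm_H.
have FC p : worm4 mu p ->
    cabs (F p) <= C * C' * expR ((a + a') * ln (cabs ((of_real4 p).1 : R[i]))).
  move=> wp; rewrite /F cabsM cabs_conjc.
  rewrite mulrDl expRD mulrACA ler_pM ?cabs_ge0//; first exact: HC.
  exact: HC'.
have aa : - 2 < a + a' by lra.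
split; apply: (integrable_worm_le aa) => // p wp; apply: le_trans (FC p wp).
  exact: Re_le_cabs.
exact: Im_le_cabs.
Qed.

End WormBergman.

(** * Orthogonality *)

Section WormSymmetries.
Local Open Scope complex_scope.
Context {R : realType}.
Implicit Types (mu : R) (l : nat) (j : int) (t : R).

Local Notation R2 := (measurableTypeR R * measurableTypeR R)%type.
Local Notation R4 := (R2 * R2)%type.
Local Notation leb2 := (@lebesgue2 R).
Local Notation leb4 := (@lebesgue4 R).

Definition rotate_snd t (p : R4) : R4 := (p.1, rot (cos t) (sin t) p.2).

Definition worm_flow t (p : R4) : R4 :=
  (rot (cos t) (sin t) p.1,
   (expR (t / 2) * (p.2.1 : R), expR (t / 2) * (p.2.2 : R))).

Lemma of_real4_rotate_snd t p : of_real4 (rotate_snd t p) =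
  ((of_real4 p).1, cexp ('i * t%:C) * ((of_real4 p).2 : R[i])).
Proof.
rewrite cexp_i /of_real4 /rotate_snd /rot /=; congr pair.
by apply/eqP; rewrite eq_complex /= !eqxx /= addrC.
Qed.

Lemma of_real4_worm_flow t p : of_real4 (worm_flow t p) =
  (cexp ('i * t%:C) * ((of_real4 p).1 : R[i]),
   (expR (t / 2))%:C * ((of_real4 p).2 : R[i])).
Proof.
rewrite cexp_i /of_real4 /worm_flow /rot /=; congr pair; apply/eqP.
  by rewrite eq_complex /= !eqxx /= addrC.
by rewrite eq_complex /= !mul0r subr0 addr0 !eqxx.
Qed.

Lemma scales_rotate_snd t : scales_measure leb4 (rotate_snd t) 1.
Proof.
rewrite -(mulr1 1).
exact: (scales_measure_prod ler01 ler01 (scales_measure_id leb2)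
  (scales_lebesgue2_rot (cos2Dsin2 t))).
Qed.

(** The dilation by [e^(t/2)] acts on two real coordinates; the rotation preserves area. *)
Lemma scales_worm_flow t : scales_measure leb4 (worm_flow t) (expR t).
Proof.
have -> : expR t = 1 * expR (t / 2) ^+ 2.
  by rewrite mul1r expr2 -expRD -splitr.
exact: (scales_measure_prod ler01 (sqr_ge0 _)
  (scales_lebesgue2_rot (cos2Dsin2 t)) (scales_lebesgue2_dilation (expR_gt0 _))).
Qed.

Lemma cabs_cexp_i t : cabs (cexp ('i * t%:C)) = 1.
Proof. by rewrite cabs_cexp cReM /= !mul0r mulr0 subr0 expR0. Qed.

Lemma logsq_rotate_snd t p :
  logsq (of_real4 (rotate_snd t p)).2 = logsq (of_real4 p).2.
Proof. by rewrite of_real4_rotate_snd /logsq cabsM cabs_cexp_i mul1r. Qed.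

Lemma worm_zeta_rotate_snd t p :
  worm_zeta (of_real4 (rotate_snd t p)) = worm_zeta (of_real4 p).
Proof. by rewrite /worm_zeta logsq_rotate_snd of_real4_rotate_snd. Qed.

Lemma worm4_rotate_snd mu t : rotate_snd t @^-1` worm4 mu = worm4 mu.
Proof.
apply/seteqP; split=> p; rewrite /preimage /mkset !worm4P.
all: rewrite worm_zeta_rotate_snd logsq_rotate_snd of_real4_rotate_snd.
all: by rewrite mulf_eq0 negb_or cexp_neq0.
Qed.

(** [L] depends on [z2] through [|z2|] only, so the rotation is felt by [z2^j] alone. *)
Lemma worm_H_rotate_snd mu (c0 : R) l j t p :
  worm_H mu c0 l j (of_real4 (rotate_snd t p)) =
  cexp ('i * (j%:~R * t)%:C) * worm_H mu c0 l j (of_real4 p).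
Proof.
have LE : worm_L (of_real4 (rotate_snd t p)) = worm_L (of_real4 p).
  rewrite /worm_L -/(worm_zeta (of_real4 (rotate_snd t p))).
  by rewrite worm_zeta_rotate_snd logsq_rotate_snd.
rewrite !worm_HE LE of_real4_rotate_snd /= expfzMl cexp_exprz mulrCA.
congr (_ * _); congr cexp.
by rewrite rmorphM rmorph_int mulrCA.
Qed.

Lemma logsq_worm_flow t p : ((of_real4 p).2 : R[i]) != 0 ->
  logsq (of_real4 (worm_flow t p)).2 = logsq (of_real4 p).2 + t.
Proof.
move=> p0; rewrite of_real4_worm_flow /logsq cabsM.
have -> : cabs (expR (t / 2))%:C = expR (t / 2).
  by rewrite /cabs /= expr0n addr0 sqrtr_sqr ger0_norm// expR_ge0.
rewrite exprMn lnM ?posrE ?exprn_gt0 ?expR_gt0 ?cabs_gt0//.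
by rewrite -expRM_natl expRK addrC mulrC divfK// pnatr_eq0.
Qed.

(** The rotation of [z1] by [t] compensates the shift of [log |z2|^2] by [t]. *)
Lemma worm_zeta_worm_flow t p : ((of_real4 p).2 : R[i]) != 0 ->
  worm_zeta (of_real4 (worm_flow t p)) = worm_zeta (of_real4 p).
Proof.
move=> p0; rewrite /worm_zeta logsq_worm_flow// of_real4_worm_flow /=.
rewrite mulrAC -cexpD [RHS]mulrC; congr (cexp _ * _).
by rewrite rmorphD; ring.
Qed.

Lemma worm_L_worm_flow t p : ((of_real4 p).2 : R[i]) != 0 ->
  worm_L (of_real4 (worm_flow t p)) = worm_L (of_real4 p) + 'i * t%:C.
Proof.
move=> p0; rewrite /worm_L -/(worm_zeta (of_real4 (worm_flow t p))).
by rewrite worm_zeta_worm_flow// logsq_worm_flow// rmorphD mulrDr addrA.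
Qed.

Lemma of_real4_worm_flow_neq0 t p :
  (((of_real4 (worm_flow t p)).2 : R[i]) != 0) = (((of_real4 p).2 : R[i]) != 0).
Proof.
rewrite of_real4_worm_flow mulf_eq0 negb_or.
by rewrite (_ : _%:C != 0)// eq_complex /= eqxx andbT expR_eq0.
Qed.

Lemma worm4_worm_flow mu t p : worm4 mu (worm_flow t p) <->
  [/\ ((of_real4 p).2 : R[i]) != 0, cabs (worm_zeta (of_real4 p) - 1) ^+ 2 < 1 &
    - mu < logsq (of_real4 p).2 + t < mu].
Proof.
rewrite worm4P of_real4_worm_flow_neq0; split=> -[p0].
all: by rewrite worm_zeta_worm_flow// logsq_worm_flow.
Qed.

(** As [L] becomes [L + it], the exponential gains [e^(i (c0 + nu l) t) e^(-(j + 1) t/2)] while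
    [z2^j] gains [e^(j t/2)]. Each [H] thus contributes [e^(-t/2)] and a phase, and [c0] drops out
    of the product with the conjugate. *)
Lemma worm_HM_worm_flow mu (c0 : R) l l' j t p : ((of_real4 p).2 : R[i]) != 0 ->
  worm_H mu c0 l j (of_real4 (worm_flow t p)) *
    conjc (worm_H mu c0 l' j (of_real4 (worm_flow t p)) : R[i]) =
  (expR (- t))%:C * cexp ('i * (pi / (2 * mu) * (l%:R - l'%:R) * t)%:C) *
    (worm_H mu c0 l j (of_real4 p) * conjc (worm_H mu c0 l' j (of_real4 p) : R[i])).
Proof.
move=> p0.
have HE k : worm_H mu c0 k j (of_real4 (worm_flow t p)) =
    cexp (worm_eta mu c0 k j * ('i * t%:C) + (j%:~R * (t / 2))%:C) *
    worm_H mu c0 k j (of_real4 p).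
  rewrite !worm_HE worm_L_worm_flow// of_real4_worm_flow /= expfzMl.
  have -> : (expR (t / 2))%:C = cexp ((t / 2)%:C) :> R[i].
    by rewrite /cexp /= cos0 sin0 mulr1 mulr0.
  have jt : (j%:~R * (t / 2))%:C = j%:~R * (t / 2)%:C :> R[i].
    by rewrite rmorphM rmorph_int.
  rewrite cexp_exprz mulrDr !cexpD jt.
  by rewrite [cexp (_ * worm_L _) * cexp (_ * ('i * _))]mulrC mulrACA.
rewrite !HE conjcM conjc_cexp mulrACA -cexpD; congr (_ * _).
have -> : (expR (- t))%:C = cexp ((- t)%:C) :> R[i].
  by rewrite /cexp /= cos0 sin0 mulr1 mulr0.
rewrite -cexpD; congr cexp; apply/eqP; rewrite /worm_eta.
move: (pi / (2 * mu)) => nu.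
by rewrite eq_complex /=; apply/andP; split; apply/eqP; rewrite intrD; field.
Qed.

End WormSymmetries.

(** * Vanishing of the inner products *)

Section WormOrthogonality.
Local Open Scope complex_scope.
Context {R : realType}.
Implicit Types (mu : R) (l : nat) (j : int) (t : R).

Local Notation R2 := (measurableTypeR R * measurableTypeR R)%type.
Local Notation R4 := (R2 * R2)%type.
Local Notation leb := (@lebesgue_measure R).
Local Notation leb2 := (@lebesgue2 R).
Local Notation leb4 := (@lebesgue4 R).

(** The parameter is the square of the radius, to match the level sets of [logsq]. *)
Definition circle2 t : set R2 :=
  [set q | (q.1 : R) ^+ 2 + (q.2 : R) ^+ 2 = t].

Lemma measurable_circle2 t : measurable (circle2 t).
Proof.
have mf : measurable_fun setT (fun q : R2 => (q.1 : R) ^+ 2 + (q.2 : R) ^+ 2).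
  by apply: measurable_funD; apply: measurable_funX.
have := mf measurableT [set t] (measurable_set1 t).
by rewrite setTI.
Qed.

(** Every vertical section has at most two points, hence length zero. *)
Lemma lebesgue2_circle2 t : leb2 (circle2 t) = 0%E.
Proof.
rewrite /lebesgue2 /product_measure1; apply: integral0_eq => x _ /=.
have mx := measurable_xsection x (measurable_circle2 t).
(* For [t < x^2] the root takes the default value 0, which is harmless as the section is then
   empty. *)
pose s := Num.sqrt (t - (x : R) ^+ 2).
have sub : xsection (circle2 t) x `<=` [set s] `|` [set - s].
  move=> y; rewrite /xsection /= inE /circle2 /mkset /= => xy.
  have : (y : R) ^+ 2 == s ^+ 2.
    have e : t - (x : R) ^+ 2 = (y : R) ^+ 2 by rewrite -xy; ring.
    by rewrite /s e sqr_sqrtr// sqr_ge0.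
  by rewrite eqf_sqr => /orP[/eqP ->|/eqP ->]; [left|right].
apply/eqP; rewrite eq_le measure_ge0 andbT.
apply: (@le_trans _ _ (leb ([set s] `|` [set - s]))).
  by apply: le_measure => //; rewrite inE//; apply: measurableU.
apply: (le_trans (measureU2 _ _ _)) => //.
rewrite -(adde0 0%E); apply: leeD; rewrite le_eqVlt; apply/orP; left; apply/eqP.
  exact: lebesgue_measure_set1.
exact: lebesgue_measure_set1.
Qed.

(** The part left out, where [log |z2|^2 = t], lies over a circle in the [z2] plane and is a null
    set. *)
Lemma Rintegral_worm_split mu t (f : R4 -> R) :
  leb4.-integrable (worm4 mu) (EFin \o f) ->
  (\int[leb4]_(p in worm4 mu) f p =
   \int[leb4]_(p in worm4 mu `&` [set p | logsq (of_real4 p).2 < t]) f p +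
   \int[leb4]_(p in worm4 mu `&` [set p | t < logsq (of_real4 p).2]) f p)%R.
Proof.
move=> intf.
have mW := measurable_worm4 mu.
pose N : set R4 := setT `*` circle2 (expR t).
have mN : measurable N by apply: measurableX => //; exact: measurable_circle2.
have N0 : leb4 N = 0%E.
  (* The first factor is infinite; its product with 0 is 0 in the extended reals. *)
  transitivity (leb2 setT * leb2 (circle2 (expR t)))%E.
    by apply: product_measure1E => //; exact: measurable_circle2.
  by rewrite lebesgue2_circle2 mule0.
have mlt : measurable (worm4 mu `&` [set p | logsq (of_real4 p).2 < t]).
  by apply: measurableI => //; apply: measurable_set_lt => //; exact: measurable_logsq4.
have mgt : measurable (worm4 mu `&` [set p | t < logsq (of_real4 p).2]).
  by apply: measurableI => //; apply: measurable_set_lt => //; exact: measurable_logsq4.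
have NE p : worm4 mu p -> N p <-> logsq (of_real4 p).2 = t.
  case=> p20 _ _.
  have -> : N p <-> cabs ((of_real4 p).2 : R[i]) ^+ 2 = expR t.
    by rewrite sqr_cabs; split=> [[]|].
  split=> [|<-]; first by rewrite /logsq => ->; rewrite expRK.
  by rewrite /logsq lnK// posrE exprn_gt0// cabs_gt0.
have DE : worm4 mu `\` N =
    (worm4 mu `&` [set p | logsq (of_real4 p).2 < t]) `|`
    (worm4 mu `&` [set p | t < logsq (of_real4 p).2]).
  apply/seteqP; split=> p.
    move=> [wp Np]; have : logsq (of_real4 p).2 != t.
      by apply/eqP => h; apply: Np; exact/(NE p wp).
    by rewrite neq_lt => /orP[h|h]; [left|right].
  move=> [[wp h]|[wp h]]; split=> // /(NE p wp) e; move: h; rewrite /mkset e ltxx//.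
rewrite -Rintegral_setU//; last 2 first.
- by rewrite -DE; apply: integrableS intf => //; exact: measurableD.
- rewrite disj_set2E; apply/eqP/seteqP; split=> // p [[_ /= h1] [_ /= h2]].
  by have := lt_trans h1 h2; rewrite ltxx.
by rewrite /Rintegral -DE; congr fine; exact: negligible_integral.
Qed.

Lemma Rintegral_rotate_eq0 mu t (f : R4 -> R) :
  leb4.-integrable (worm4 mu) (EFin \o f) ->
  (forall p, f (rotate_snd t p) = - f p) ->
  (\int[leb4]_(p in worm4 mu) f p = 0)%R.
Proof.
move=> intf fT.
have h := Rintegral_scales_opp ltr01 (scales_rotate_snd t) (measurable_worm4 mu) intf.
rewrite worm4_rotate_snd in h.
have : (\int[leb4]_(p in worm4 mu) f p = - \int[leb4]_(p in worm4 mu) f p)%R.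
  by apply: h => p _; rewrite fT invr1 mul1r.
by lra.
Qed.

(** The flow by [s] carries the part below level [mu - s] onto the part above [s - mu], and the flow
    by [s - 2 mu] carries the part above [mu - s] onto the part below [s - mu]. Each changes the
    sign of the integral; cutting the domain once at each level and adding gives [I = - I]. *)
Lemma Rintegral_flow_eq0 mu s (f : R4 -> R) : 0 < s -> s < 2 * mu ->
  leb4.-integrable (worm4 mu) (EFin \o f) ->
  (forall t p, t = s \/ t = s - 2 * mu -> ((of_real4 p).2 : R[i]) != 0 ->
     f (worm_flow t p) = - ((expR t)^-1 * f p)) ->
  (\int[leb4]_(p in worm4 mu) f p = 0)%R.
Proof.
move=> s0 smu intf fT.
have mW := measurable_worm4 mu.
pose lo c := worm4 mu `&` [set p | logsq (of_real4 p).2 < c].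
pose hi c := worm4 mu `&` [set p | c < logsq (of_real4 p).2].
have mlo c : measurable (lo c).
  by apply: measurableI => //; apply: measurable_set_lt => //; exact: measurable_logsq4.
have mhi c : measurable (hi c).
  by apply: measurableI => //; apply: measurable_set_lt => //; exact: measurable_logsq4.
have intS D : measurable D -> D `<=` worm4 mu -> leb4.-integrable D (EFin \o f).
  by move=> mD DW; exact: integrableS intf.
have hiE : worm_flow s @^-1` hi (s - mu) = lo (mu - s).
  apply/seteqP; split=> p.
    move=> [/worm4_worm_flow[p0 p1 /andP[p2 p3]]].
    rewrite /mkset logsq_worm_flow// => p4; split; last by rewrite /mkset; lra.
    by apply/worm4P; split=> //; apply/andP; split; lra.
  move=> [/worm4P[p0 p1 /andP[p2 p3]]]; rewrite /mkset => p4.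
  split; last by rewrite /mkset logsq_worm_flow//; lra.
  by apply/worm4_worm_flow; split=> //; apply/andP; split; lra.
have loE : worm_flow (s - 2 * mu) @^-1` lo (s - mu) = hi (mu - s).
  apply/seteqP; split=> p.
    move=> [/worm4_worm_flow[p0 p1 /andP[p2 p3]]].
    rewrite /mkset logsq_worm_flow// => p4; split; last by rewrite /mkset; lra.
    by apply/worm4P; split=> //; apply/andP; split; lra.
  move=> [/worm4P[p0 p1 /andP[p2 p3]]]; rewrite /mkset => p4.
  split; last by rewrite /mkset logsq_worm_flow//; lra.
  by apply/worm4_worm_flow; split=> //; apply/andP; split; lra.
have E1 : (\int[leb4]_(p in hi (s - mu)) f p = - \int[leb4]_(p in lo (mu - s)) f p)%R.
  rewrite -hiE; apply: (Rintegral_scales_opp (expR_gt0 s) (scales_worm_flow s)) => //.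
    by apply: intS => // p [].
  by move=> p [/worm4_worm_flow[p0 _ _] _]; apply: fT => //; left.
have E2 : (\int[leb4]_(p in lo (s - mu)) f p = - \int[leb4]_(p in hi (mu - s)) f p)%R.
  rewrite -loE; apply: (Rintegral_scales_opp (expR_gt0 _) (scales_worm_flow _)) => //.
    by apply: intS => // p [].
  by move=> p [/worm4_worm_flow[p0 _ _] _]; apply: fT => //; right.
have S1 := Rintegral_worm_split (s - mu) intf.
have S2 := Rintegral_worm_split (mu - s) intf.
rewrite -/(lo _) -/(hi _) in S1 S2.
by rewrite E1 E2 in S1; lra.
Qed.

Lemma complex_integral_rotate_eq0 mu t (F : C2 R -> R[i]) :
  leb4.-integrable (worm4 mu) (EFin \o (fun p => Re (F (of_real4 p)))) ->
  leb4.-integrable (worm4 mu) (EFin \o (fun p => Im (F (of_real4 p)))) ->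
  (forall p, F (of_real4 (rotate_snd t p)) = - F (of_real4 p)) ->
  complex_integral (truncated_worm mu) F = 0.
Proof.
move=> intr inti FT; apply/eqP; rewrite eq_complex.
apply/andP; split; apply/eqP.
  by apply: (@Rintegral_rotate_eq0 mu t _ intr) => p; rewrite FT cReN.
by apply: (@Rintegral_rotate_eq0 mu t _ inti) => p; rewrite FT cImN.
Qed.

Lemma complex_integral_flow_eq0 mu s (F : C2 R -> R[i]) : 0 < s -> s < 2 * mu ->
  leb4.-integrable (worm4 mu) (EFin \o (fun p => Re (F (of_real4 p)))) ->
  leb4.-integrable (worm4 mu) (EFin \o (fun p => Im (F (of_real4 p)))) ->
  (forall t p, t = s \/ t = s - 2 * mu -> ((of_real4 p).2 : R[i]) != 0 ->
     F (of_real4 (worm_flow t p)) = (- (expR t)^-1)%:C * F (of_real4 p)) ->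
  complex_integral (truncated_worm mu) F = 0.
Proof.
move=> s0 smu intr inti FT; apply/eqP; rewrite eq_complex.
apply/andP; split; apply/eqP.
  apply: (Rintegral_flow_eq0 s0 smu intr) => t p ts p0.
  by rewrite FT// cReM /= mul0r subr0 mulNr.
apply: (Rintegral_flow_eq0 s0 smu inti) => t p ts p0.
by rewrite FT// cImM /= mul0r addr0 mulNr.
Qed.

Lemma bergman_inner_worm_H_neq mu (c0 : R) l l' j j' : 0 < mu -> -1 < c0 ->
  j != j' ->
  bergman_inner (truncated_worm mu) (worm_H mu c0 l j) (worm_H mu c0 l' j') = 0.
Proof.
move=> mu0 c01 jj'.
have [intr inti] := integrable_worm_HM l j l' j' mu0 c01.
pose t : R := pi / (j - j')%:~R.
apply: (@complex_integral_rotate_eq0 mu t) => // p.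
rewrite !worm_H_rotate_snd conjcM conjc_cexp mulrACA -cexpD -[RHS]mulN1r.
congr (_ * _); rewrite -cexp_ipi; congr cexp; apply/eqP.
have jt : j%:~R * t - j'%:~R * t = pi.
  by rewrite -mulrBl -intrB /t mulrCA divff ?mulr1// intr_eq0 subr_eq0.
by rewrite eq_complex /= !mul0r !mul1r -jt; apply/andP; split; apply/eqP; ring.
Qed.

(** The two exponential conditions say that the phase of the integrand changes by -1 under both maps
    that make up the cyclic shift. *)
Lemma bergman_inner_worm_H_eq mu (c0 s : R) l l' j : 0 < mu -> -1 < c0 ->
  0 < s -> s < 2 * mu ->
  cexp ('i * (pi / (2 * mu) * (l%:R - l'%:R) * s)%:C) = -1 ->
  cexp ('i * (pi / (2 * mu) * (l%:R - l'%:R) * (s - 2 * mu))%:C) = -1 ->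
  bergman_inner (truncated_worm mu) (worm_H mu c0 l j) (worm_H mu c0 l' j) = 0.
Proof.
move=> mu0 c01 s0 smu e1 e2.
have [intr inti] := integrable_worm_HM l j l' j mu0 c01.
apply: (complex_integral_flow_eq0 s0 smu) => // t p ts p0.
have -> := worm_HM_worm_flow mu c0 l l' j t p0; congr (_ * _).
by case: ts => ->; rewrite ?e1 ?e2 mulrN1 -rmorphN -expRN.
Qed.

Lemma bergman_inner_worm_H_parity mu (c0 : R) l l' (m : int) j : 0 < mu -> -1 < c0 ->
  l%:Z - l'%:Z = 2 * m -> m != 0 ->
  bergman_inner (truncated_worm mu) (worm_H mu c0 l j) (worm_H mu c0 l' j) = 0.
Proof.
move=> mu0 c01 lm m0.
have lmR : l%:R - l'%:R = 2 * m%:~R :> R.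
  by have := congr1 (fun x : int => x%:~R : R) lm; rewrite intrB intrM.
have am0 : 0 < `|m%:~R| :> R by rewrite normr_gt0 intr_eq0.
have am1 : 1 <= `|m%:~R| :> R by rewrite -intr_norm ler1z -gtz0_ge1 normr_gt0.
pose s : R := mu / `|m%:~R|.
have s0 : 0 < s by rewrite divr_gt0.
(* As a nonzero integer [m] has [|m| >= 1], which keeps the shift shorter than the interval. *)
have smu : s <= mu by rewrite ler_pdivrMr// ler_peMr// ltW.
have e1 : cexp ('i * (pi / (2 * mu) * (l%:R - l'%:R) * s)%:C) = -1 :> R[i].
  rewrite lmR /s.
  (* The angle is [pi] or [- pi] according to the sign of [m]; both give -1. *)
  have [x0|x0|/eqP] := ltrgtP (m%:~R : R) 0; last by rewrite intr_eq0 (negbTE m0).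
    rewrite ltr0_norm//.
    have -> : pi / (2 * mu) * (2 * m%:~R) * (mu / - m%:~R) = - pi :> R.
      by field; rewrite lt_eqF// gt_eqF.
    by rewrite rmorphN mulrN cexpN cexp_ipi invrN1.
  rewrite gtr0_norm//.
  have -> : pi / (2 * mu) * (2 * m%:~R) * (mu / m%:~R) = pi :> R.
    by field; rewrite !gt_eqF.
  exact: cexp_ipi.
have e2 : cexp ('i * (pi / (2 * mu) * (l%:R - l'%:R) * (s - 2 * mu))%:C) = -1 :> R[i].
  (* Evenness of [l - l'] enters here: moving [t] by [- 2 mu] changes the angle by [- 2 pi m], a
     full number of turns. *)
  have -> : pi / (2 * mu) * (l%:R - l'%:R) * (s - 2 * mu) =
     pi / (2 * mu) * (l%:R - l'%:R) * s + (2 * - m)%:~R * pi :> R.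
    by rewrite lmR intrM intrN; field; rewrite gt_eqF.
  rewrite rmorphD mulrDr cexpD e1 rmorphM rmorph_int mulrCA -cexp_exprz cexp_ipi.
  rewrite -exprz_exp.
  have -> : (-1) ^ 2 = 1 :> R[i] by rewrite -[LHS]/((-1) ^+ 2) sqrrN expr1n.
  by rewrite exp1rz mulr1.
by apply: (bergman_inner_worm_H_eq j mu0 c01 s0 _ e1 e2); lra.
Qed.

End WormOrthogonality.

Theorem corollary1p5 (R : realType) (mu c0 : R) (hmu : 0 < mu) (hc0 : -1 < c0) :
  orthogonal_system (truncated_worm mu)
    (fun kj : nat * int => worm_H mu c0 (2 * kj.1)%N kj.2) /\
  orthogonal_system (truncated_worm mu)
    (fun kj : nat * int => worm_H mu c0 (2 * kj.1 + 1)%N kj.2).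
Proof.
(* Both families have the form [H_(g k, j)], with [g k = 2 k] or [g k = 2 k + 1]; in either case the
   differences of [g] are [2 (k - k')]. *)
have orth (g : nat -> nat) :
    (forall k k', (g k)%:Z - (g k')%:Z = 2 * (k%:Z - k'%:Z)) ->
    orthogonal_system (truncated_worm mu)
      (fun kj : nat * int => worm_H mu c0 (g kj.1) kj.2).
  move=> gE; split=> [[k j]|[k j] [k' j'] neq]; first exact: bergman_worm_H.
  have [jj'|jj'] := eqVneq j j'; last exact: bergman_inner_worm_H_neq.
  rewrite /= -jj'; apply: bergman_inner_worm_H_parity (gE k k') _ => //.
  by rewrite subr_eq0; apply/eqP => -[kk']; apply: neq; rewrite kk' jj'.
by split; [apply: (orth (muln 2))|apply: (orth (fun k => 2 * k + 1)%N)] => k k'; lia.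
Qed.
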